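(* For a minor-closed class $\mathcal{G}$ of graphs, the following are equivalent: (1) some apex-forest graph is not in $\mathcal{G}$; (2) $\mathcal{G}$ has bounded local pathwidth; (3) $\mathcal{G}$ has linear local pathwidth; (4) $\mathcal{G}$ has bounded layered pathwidth; (5) there exist integers $w$ and $p$ such that every graph in $\mathcal{G}$ has a $(w,p)$-good tree decomposition.
   Context: All graphs are finite and simple. A class is minor-closed if it contains every minor of each of its members. A graph $G$ is an apex-forest if $G-v$ is a forest for some vertex $v$. A tree decomposition of $G$ is a family $(B_x\subseteq V(G): x\in V(T))$ indexed by the nodes of a tree $T$ such that each edge of $G$ has both endpoints in some bag and, for each $v\in V(G)$, the set of nodes $x$ with $v\in B_x$ induces a non-empty connected subtree $T[v]$ of $T$; its width is the maximum bag size minus 1. A path decomposition is a tree decomposition indexed by a path; the pathwidth $\operatorname{pw}(G)$ is the minimum width of a path decomposition of $G$. A tree decomposition is $(w,p)$-good if its width is at most $w$ and $\operatorname{pw}(T[v])\le p$ for every $v\in V(G)$. A layering of $G$ is a partition $(V_0,\dots,V_t)$ of $V(G)$ such that every edge joins vertices in the same or consecutive layers. The layered width of a path decomposition is the minimum $\ell$ such that for some layering each bag has at most $\ell$ vertices in each layer; the layered pathwidth of $G$ is the minimum layered width of a path decomposition of $G$. $\mathcal{G}$ has bounded layered pathwidth if some constant bounds the layered pathwidth of all its members. $\mathcal{G}$ has bounded local pathwidth if there is a function $f$ such that for every $G\in\mathcal{G}$, every vertex $v$ and every integer $r\ge 0$, the subgraph of $G$ induced by the vertices at distance at most $r$ from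 $v$ has pathwidth at most $f(r)$; it has linear local pathwidth if such an $f$ can be chosen to be a linear function. *)

(* Defs.v *)
From mathcomp Require Import all_boot.
Set Implicit Arguments. Unset Strict Implicit. Unset Printing Implicit Defensive.

Record sgraph := SGraph {
  gV :> finType;
  gadj : rel gV;
  gsym : symmetric gadj;
  girr : irreflexive gadj }.
Arguments gadj : clear implicits.

Section Defs.
Variable V : finType.
Implicit Types (e : rel V) (A S : {set V}).

Definition restr e S : rel V := fun a b => [&& e a b, a \in S & b \in S].

Definition connected_in e S : Prop :=
  forall x y, x \in S -> y \in S -> connect (restr e S) x y.

Definition has_cycle_in e S : Prop :=
  exists s : seq V, [/\ uniq s, 2 < size s, all (fun x => x \in S) s & cycle e s].

Fixpoint ball e (r : nat) (v : V) : {set V} :=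
  match r with
  | 0 => [set v]
  | r'.+1 => ball e r' v :|: [set u | [exists x in ball e r' v, e x u]]
  end.
End Defs.

Definition is_tree (X : finType) (eX : rel X) : Prop :=
  [/\ symmetric eX, irreflexive eX, 0 < #|X|,
      connected_in eX [set: X] & ~ has_cycle_in eX [set: X]].

Definition is_path_graph (X : finType) (eX : rel X) : Prop :=
  is_tree eX /\ forall x, #|[set y | eX x y]| <= 2.

Definition tree_decomp (V : finType) (e : rel V) (A : {set V})
    (X : finType) (eX : rel X) (B : X -> {set V}) : Prop :=
  [/\ forall x, B x \subset A,
      forall u v, u \in A -> v \in A -> e u v -> exists x, (u \in B x) && (v \in B x),
      forall v, v \in A -> exists x, v \in B x &
      forall v, v \in A -> connected_in eX [set x | v \in B x]].

Definition width_le (V X : finType) (B : X -> {set V}) (w : nat) : Prop :=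
  forall x, #|B x| <= w.+1.

Definition pathwidth_le (V : finType) (e : rel V) (A : {set V}) (p : nat) : Prop :=
  exists (X : finType) (eX : rel X) (B : X -> {set V}),
    [/\ is_path_graph eX, tree_decomp e A eX B & width_le B p].

Definition has_good_td (G : sgraph) (w p : nat) : Prop :=
  exists (X : finType) (eX : rel X) (B : X -> {set gV G}),
    [/\ is_tree eX, tree_decomp (gadj G) (setT : {set gV G}) eX B, width_le B w &
        forall v : gV G, pathwidth_le eX [set x | v \in B x] p].

(* layering: L v is the index of the layer of v *)
Definition layering (G : sgraph) (L : gV G -> nat) : Prop :=
  forall u v, gadj G u v -> (L u <= (L v).+1) && (L v <= (L u).+1).

Definition layered_pw_le (G : sgraph) (l : nat) : Prop :=
  exists (X : finType) (eX : rel X) (B : X -> {set gV G}) (L : gV G -> nat),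
    [/\ is_path_graph eX, tree_decomp (gadj G) (setT : {set gV G}) eX B, layering L &
        forall x i, #|[set v in B x | L v == i]| <= l].

Definition minor (H G : sgraph) : Prop :=
  exists phi : gV H -> {set gV G},
    [/\ forall x, phi x != set0,
        forall x, connected_in (gadj G) (phi x),
        forall x y, x != y -> [disjoint phi x & phi y] &
        forall x y, gadj H x y ->
          exists u v, [&& u \in phi x, v \in phi y & gadj G u v]].

Definition minor_closed (C : sgraph -> Prop) : Prop :=
  forall G H : sgraph, C G -> minor H G -> C H.

Definition apex_forest (G : sgraph) : Prop :=
  exists v : gV G, ~ has_cycle_in (gadj G) [set~ v].

Definition bounded_local_pw (C : sgraph -> Prop) : Prop :=
  exists f : nat -> nat, forall G : sgraph, C G ->
    forall (v : gV G) (r : nat), pathwidth_le (gadj G) (ball (gadj G) r v) (f r).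

Definition linear_local_pw (C : sgraph -> Prop) : Prop :=
  exists a b : nat, forall G : sgraph, C G ->
    forall (v : gV G) (r : nat), pathwidth_le (gadj G) (ball (gadj G) r v) (a * r + b).

Definition bounded_layered_pw (C : sgraph -> Prop) : Prop :=
  exists l : nat, forall G : sgraph, C G -> layered_pw_le G l.

(* Main.v *)
Require Import Defs.
From mathcomp Require Import all_boot zify.
Set Implicit Arguments. Unset Strict Implicit. Unset Printing Implicit Defensive.

(** Suppose that [G] has no minor consisting of a tree [F] on [n] vertices plus an apex.  Let [D]
    be a set of vertices whose outside neighbours lie in a connected set [Y] disjoint from [D].
    Then [G[D]] has no [F]-model all of whose branch sets meet the set [N] of vertices of [D] with
    a neighbour outside [D], since [Y] would serve as the apex.  A version of Diestel's proof of
    the excluded forest theorem, in which all branch sets are required to meet [N], turns this into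
    a path decomposition, with bags of size at most [3n], of a core [A] of [D] that contains [N],
    each component of [D \ A] being attached to a single bag.  If some neighbour of such a
    component [K] is not joined to [Y] outside [K], the part of [D] cut off by [K] can be taken out
    of the core, so with [A] minimal every component satisfies the hypothesis on [D] again.
    Recursion gives (4), the core of [D] forming one layer, and also (5): in the tree of bags a
    vertex of the core of [D] occupies only nodes of the path of [D] and of paths attached to it,
    because the core of each component contains all its vertices adjacent to [A], so that [A] has
    no neighbour in the components at the next level.

    (4) implies (3) because a ball of radius [r] meets at most [2r+1] layers.  Conversely, a
    ternary tree plus an apex is a ball of radius 1 of large pathwidth, so (2) implies (1); and it
    has no good tree decomposition, since by the Helly property the bags containing the apex would
    cover everything, and a path decomposition of the subtree they form would expand into one of
    the graph. *)

(** * Connected sets *)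

Section Connected.
Variable V : finType.
Implicit Types (e : rel V) (S T : {set V}).

Lemma restr_sym e S : symmetric e -> symmetric (restr e S).
Proof. by move=> es a b; rewrite /restr es; case: (e b a) => //=; rewrite andbC. Qed.

Lemma restr_connect_sym e S : symmetric e -> connect_sym (restr e S).
Proof. by move=> es; apply/sym_connect_sym/restr_sym. Qed.

Lemma connect_restr_mem e S x y : connect (restr e S) x y -> x = y \/ x \in S /\ y \in S.
Proof.
move=> /connectP[p]; elim: p x => [|z p IH] x /=; first by move=> _ ->; left.
move=> /andP[/and3P[_ xS zS] zp] yl; right; split=> //.
by case: (IH z zp yl) => [<-|[]].
Qed.

Lemma connect_restr_sub e e' S T x y : subrel e e' -> S \subset T ->
  connect (restr e S) x y -> connect (restr e' T) x y.
Proof.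
move=> ee' /subsetP ST; apply: connect_sub => a b /and3P[ab aS bS].
by apply: connect1; rewrite /restr ee' // !ST.
Qed.

Lemma connected_sub_rel e e' S : subrel e e' -> connected_in e S -> connected_in e' S.
Proof. by move=> ee' cS x y xS yS; apply: connect_restr_sub (cS x y xS yS). Qed.

Lemma connected1 e x : connected_in e [set x].
Proof. by move=> a b /set1P-> /set1P->. Qed.

Lemma connected0 e : connected_in e set0.
Proof. by move=> a b; rewrite inE. Qed.

Lemma connected_from e S x : symmetric e ->
  (forall y, y \in S -> connect (restr e S) x y) -> connected_in e S.
Proof.
move=> es H a b aS bS; apply: connect_trans (H b bS).
by rewrite restr_connect_sym //; apply: H.
Qed.

Lemma connectedU e S T z : symmetric e -> connected_in e S -> connected_in e T ->
  z \in S -> z \in T -> connected_in e (S :|: T).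
Proof.
move=> es cS cT zS zT; apply: (@connected_from _ _ z) => // y /setUP[yS|yT].
  by apply: connect_restr_sub (cS z y zS yS) => //; apply: subsetUl.
by apply: connect_restr_sub (cT z y zT yT) => //; apply: subsetUr.
Qed.

Lemma connected2 e x y : symmetric e -> e x y -> connected_in e [set x; y].
Proof.
move=> es xy; apply: (@connected_from _ _ x) => // z /set2P[]-> //.
by apply: connect1; rewrite /restr xy !inE !eqxx orbT.
Qed.

Lemma connectedU_edge e S T x y : symmetric e -> connected_in e S -> connected_in e T ->
  x \in S -> y \in T -> e x y -> connected_in e (S :|: T).
Proof.
move=> es cS cT xS yT xy.
have -> : S :|: T = (S :|: [set x; y]) :|: T.
  apply/setP=> z; rewrite !inE; case: (z =P x) => [->|_]; first by rewrite xS.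
  by case: (z =P y) => [->|_]; rewrite ?yT ?orbT ?orbF.
apply: (connectedU (z := y)) => //; last by rewrite !inE eqxx !orbT.
by apply: (connectedU (z := x)) => //; [exact: connected2 | rewrite !inE eqxx].
Qed.

Lemma connected_closed e S (P : {set V}) x : connected_in e S -> x \in S -> x \in P ->
  (forall u v, u \in S -> v \in S -> e u v -> u \in P -> v \in P) -> S \subset P.
Proof.
move=> cS xS xP H; apply/subsetP=> y yS.
have /connectP[p pp ->] := cS x y xS yS.
elim: p x xS xP pp => [|z p IH] x xS xP //= /andP[/and3P[xz _ zS] zp].
by apply: IH => //; apply: H xP.
Qed.

Lemma connected_cross e S (P : {set V}) x y : connected_in e S -> x \in S -> y \in S ->
  x \in P -> y \notin P ->
  exists u v, [/\ u \in S, v \in S, e u v, u \in P & v \notin P].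
Proof.
move=> cS xS yS xP yP.
case: (pickP [pred uv : V * V |
    [&& uv.1 \in S, uv.2 \in S, e uv.1 uv.2, uv.1 \in P & uv.2 \notin P]]).
  by move=> [u v] /= /and5P[*]; exists u, v; split.
move=> H; case/negP: yP; apply: (subsetP (connected_closed cS xS xP _)) yS.
move=> u v uS vS uv uP; apply/negPn/negP => vP.
by have := H (u, v); rewrite /= uS vS uv uP vP.
Qed.

Lemma connected_component e S x : symmetric e ->
  connected_in e [set z | connect (restr e S) x z].
Proof.
move=> es; apply: (@connected_from _ _ x) => // y; rewrite inE => /connectP[p].
elim/last_ind: p y => [|p z IH] y; first by move=> _ ->.
rewrite rcons_path last_rcons => /andP[xp lz] ->{y}.
apply: connect_trans (IH _ xp erefl) _; apply: connect1.
have xl : connect (restr e S) x (last x p) by apply/connectP; exists p.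
rewrite /restr !inE xl (connect_trans xl (connect1 lz)).
by case/and3P: lz => ->.
Qed.

Lemma connected_image (W : finType) e (e' : rel W) (f : V -> W) S :
  {in S &, forall x y, e x y -> e' (f x) (f y)} ->
  connected_in e S -> connected_in e' (f @: S).
Proof.
move=> fe cS _ _ /imsetP[x xS ->] /imsetP[y yS ->].
have /connectP[p pp ->] := cS x y xS yS.
elim: p x xS pp => [|z p IH] x xS //= /andP[/and3P[xz _ zS] zp].
apply: connect_trans (IH z zS zp); apply: connect1.
by rewrite /restr fe // !imset_f.
Qed.

End Connected.

Lemma connected_bigcup (V X : finType) (e : rel V) (eX : rel X) (S : {set V})
    (F : V -> {set X}) : symmetric eX -> connected_in e S ->
  (forall v, v \in S -> connected_in eX (F v)) ->
  (forall u v, u \in S -> v \in S -> e u v -> exists x, (x \in F u) && (x \in F v)) ->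
  connected_in eX (\bigcup_(v in S) F v).
Proof.
move=> es cS cF eF x y /bigcupP[u uS xu] /bigcupP[v vS yv].
set U := \bigcup_(v in S) F v.
have FU w : w \in S -> F w \subset U by move=> wS; apply: bigcup_sup.
have /connectP[p pp E] := cS u v uS vS; subst v.
elim: p u uS x xu pp yv vS => [|z p IH] u uS x xu /=.
  by move=> _ yu _; apply: connect_restr_sub (cF u uS x y xu yu) => //; apply: FU.
move=> /andP[/and3P[uz _ zS] zp] yl lS.
have [w /andP[wu wz]] := eF u z uS zS uz.
apply: connect_trans (IH z zS w wz zp yl lS).
by apply: connect_restr_sub (cF u uS x w xu wu) => //; apply: FU.
Qed.

(** * Menger's theorem *)

Section Boundary.
Variable V : finType.
Implicit Types (e : rel V) (N X Y : {set V}).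

(** Vertices of [N] count as having an extra neighbour outside every set, so they belong to the
    boundary even when [X] is [setT]. *)
Definition bd e N X := [set x in X | (x \in N) || [exists z, (z \notin X) && e x z]].

Lemma bdP e N X x :
  reflect (x \in X /\ (x \in N \/ exists2 z, z \notin X & e x z)) (x \in bd e N X).
Proof.
rewrite inE; apply: (iffP andP) => -[xX H]; split=> //.
  case/orP: H => [|/existsP[z /andP[? ?]]]; [by left | by right; exists z].
by case: H => [->//|[z zX xz]]; apply/orP; right; apply/existsP; exists z; rewrite zX.
Qed.

Lemma bd_sub e N X : bd e N X \subset X.
Proof. by apply/subsetP=> x /bdP[]. Qed.

Lemma bd_set0 e N : bd e N set0 = set0.
Proof. by apply/setP=> x; rewrite !inE. Qed.

Lemma bd_setT e : bd e set0 setT = set0.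
Proof. by apply/setP=> x; rewrite !inE; apply/existsP=> -[z]; rewrite inE. Qed.

(** A vertex in either boundary on the left is in one of those on the right, and a vertex in both on
    the left is in both on the right. *)
Lemma bd_submod e N X Y :
  #|bd e N (X :&: Y)| + #|bd e N (X :|: Y)| <= #|bd e N X| + #|bd e N Y|.
Proof.
rewrite -cardsUI -(cardsUI (bd e N X)); apply: leq_add; apply/subset_leq_card/subsetP=> x.
  case/setUP=> /bdP[].
    rewrite inE => /andP[xX xY] [xN|[z]].
      by apply/setUP; left; apply/bdP; split=> //; left.
    rewrite inE negb_and => /orP[] zX xz; apply/setUP; [left|right]; apply/bdP; split=> //;
      by right; exists z.
  rewrite inE => xXY H; case/orP: xXY => xX; apply/setUP; [left|right]; apply/bdP; split=> //;
    case: H => [|[z]]; [by left| |by left|]; rewrite inE negb_or => /andP[zX zY] xz;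
    by right; exists z.
case/setIP=> /bdP[/setIP[xX xY] _] /bdP[_ H].
apply/setIP; split; apply/bdP; split=> //;
  case: H => [|[z]]; [by left| |by left|]; rewrite inE negb_or => /andP[zX zY] xz;
  by right; exists z.
Qed.

(** Disjoint connected sets stand in for the disjoint paths of Menger's theorem. *)
Definition linkage e N X X' (P : V -> {set V}) :=
  [/\ forall a, a \in bd e N X ->
        [/\ a \in P a, connected_in e (P a), P a \subset a |: X' :\: X &
            exists2 b, b \in P a & b \in bd e N X'] &
      forall a b, a \in bd e N X -> b \in bd e N X -> a != b -> [disjoint P a & P b]].

(** The sets of [P1] lie in [Y], while those of [P2] meet [Y] only where they start. Hence [P1 a]
    can be prolonged by the set of [P2] that starts at an end [f a] of [P1 a]. *)
Lemma linkage_comp e N X Y X' P1 P2 : symmetric e -> X \subset Y -> Y \subset X' ->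
  linkage e N X Y P1 -> linkage e N Y X' P2 -> exists P, linkage e N X X' P.
Proof.
move=> es XY YX' [H1 D1] [H2 D2].
have [f Hf] : exists f : V -> V, forall a, a \in bd e N X -> f a \in P1 a /\ f a \in bd e N Y.
  apply: (fin_all_exists (P := fun a b => a \in bd e N X -> b \in P1 a /\ b \in bd e N Y)) => a.
  by have [/H1[_ _ _ [b bP bY]]|/negbTE aX] := boolP (a \in bd e N X); [exists b | exists a].
exists (fun a => P1 a :|: P2 (f a)); split.
  move=> a aX; have [aP cP sP _] := H1 a aX; have [fP fY] := Hf a aX.
  have [fP2 cP2 sP2 [b bP2 bX']] := H2 _ fY; split.
  - by rewrite inE aP.
  - exact: connectedU fP fP2.
  - apply/subUsetP; split.
      by apply: subset_trans sP _; apply/setUS/setSD.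
    have fa := subsetP sP _ fP.
    apply: subset_trans sP2 _; apply/subUsetP; split; last first.
      by apply: subset_trans (subsetUr _ _); apply: setDS.
    rewrite sub1set; apply: subsetP fa; apply: setUS; exact: setSD.
  - by exists b; rewrite // inE bP2 orbT.
have X12 a b x : a \in bd e N X -> b \in bd e N X -> a != b -> x \in P1 a -> x \in P2 (f b) -> False.
  move=> aX bX ab xa xb.
  have [aP cP sP _] := H1 a aX; have [fP fY] := Hf b bX; have [_ _ sP2 _] := H2 _ fY.
  have xY : x \in Y.
    move: (subsetP sP x xa); rewrite !inE => /orP[/eqP->|/andP[]//].
    by apply: (subsetP XY); apply: subsetP aX; apply: bd_sub.
  move: (subsetP sP2 x xb); rewrite !inE xY /= orbF => /eqP E; subst x.
  by have := D1 a b aX bX ab; move/disjoint_setI0/setP/(_ (f b)); rewrite !inE xa fP.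
move=> a b aX bX ab; apply/pred0P=> x; apply/negbTE/negP; rewrite /= !inE.
case/andP=> /orP[xa|xa] /orP[xb|xb].
- by have := D1 a b aX bX ab; move/disjoint_setI0/setP/(_ x); rewrite !inE xa xb.
- exact: (X12 a b x).
- by apply: (X12 b a x) => //; rewrite eq_sym.
- have [fa faY] := Hf a aX; have [fb fbY] := Hf b bX.
  have fab : f a != f b.
    apply/eqP=> E; have := D1 a b aX bX ab; move/disjoint_setI0/setP/(_ (f a)).
    by rewrite !inE fa E fb.
  by have := D2 _ _ faY fbY fab; move/disjoint_setI0/setP/(_ x); rewrite !inE xa xb.
Qed.

(* Menger's theorem, with separators presented as boundaries of intermediate sets.
   If no proper intermediate set has a boundary as small as that of [X], pick an edge [a0 z]
   leaving [X], move the boundary vertex [a0] to [z] and delete the other edges leaving at [a0]: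
   all boundaries drop by at most one, so the hypothesis is preserved. *)
Lemma menger e N X X' : symmetric e -> X \subset X' ->
  (forall Y, X \subset Y -> Y \subset X' -> #|bd e N X| <= #|bd e N Y|) ->
  exists P, linkage e N X X' P.
Proof.
have [m] := ubnP #|X' :\: X|; elim: m e X X' => // m IH e X X'; rewrite ltnS => mX es XX' H.
case: (pickP [pred Y : {set V} | [&& X \proper Y, Y \proper X' & #|bd e N Y| <= #|bd e N X|]]).
  move=> Y /= /and3P[/properP[XY [y yY yX]] /properP[YX' [y' y'X' y'Y]] bY].
  have m1 : #|Y :\: X| < m.
    apply: leq_trans mX; apply: proper_card; apply/properP; split; first exact: setSD.
    by exists y'; rewrite !inE ?(negbTE y'Y) ?andbF // y'X' andbT; apply: contra y'Y; apply: subsetP.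
  have m2 : #|X' :\: Y| < m.
    apply: leq_trans mX; apply: proper_card; apply/properP; split; first exact: setDS.
    by exists y; rewrite !inE ?yY // yX (subsetP YX').
  have [|P1 L1] := IH e X Y m1 es XY.
    by move=> Z XZ ZY; apply: H => //; apply: subset_trans YX'.
  have [|P2 L2] := IH e Y X' m2 es YX'.
    by move=> Z YZ ZX'; apply: leq_trans bY _; apply: H => //; apply: subset_trans YZ.
  exact: (linkage_comp es XY YX' L1 L2).
move=> noY.
have [sX|] := boolP (bd e N X \subset bd e N X').
  exists (fun a => [set a]); split.
    move=> a aX; split; rewrite ?inE ?eqxx //; first exact: connected1.
      by rewrite sub1set !inE eqxx.
    by exists a; [rewrite inE eqxx | apply: (subsetP sX)].
  by move=> a b _ _ ab; rewrite disjoints1 inE.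
case/subsetPn=> a0 a0X a0X'.
have [a0inX a0z] := bdP _ _ _ _ a0X.
have a0inX' := subsetP XX' _ a0inX.
have a0N : a0 \notin N by apply: contra a0X' => a0N; apply/bdP; split=> //; left.
case: a0z => [a0N'|[z zX a0z]]; first by rewrite a0N' in a0N.
have zX' : z \in X'.
  by apply/negPn/negP=> zX'; case/negP: a0X'; apply/bdP; split=> //; right; exists z.
pose X2 := z |: X.
pose e2 : rel V := fun u v =>
  [&& e u v, ~~ ((u == a0) && (v \notin X2)) & ~~ ((v == a0) && (u \notin X2))].
have e2e : subrel e2 e by move=> u v /andP[].
have e2s : symmetric e2.
  by move=> u v; rewrite /e2 es; case: (e v u) => //=; rewrite andbC.
have XX2 : X \subset X2 by apply: subsetUr.
have X2X' : X2 \subset X' by apply/subUsetP; rewrite sub1set.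
have za0 : z != a0 by apply: contraNneq zX => ->.
have F1 : bd e2 N X2 \subset z |: (bd e N X :\ a0).
  apply/subsetP=> y /bdP[]; rewrite !inE; case: eqP => //= yz yX H'.
  rewrite yX /=; case: H' => [yN|[w]].
    by rewrite yN andbT; apply: contraNneq a0N => <-.
  move=> wX2; rewrite /e2 wX2 andbT => /and3P[yw ya0 _]; rewrite ya0 /=.
  apply/orP; right; apply/existsP; exists w; rewrite yw andbT.
  by move: wX2; rewrite !inE negb_or => /andP[].
have F2 Y : X2 \subset Y -> Y \subset X' -> bd e N Y :\ a0 \subset bd e2 N Y.
  move=> X2Y YX'; apply/subsetP=> y; rewrite in_setD1 => /andP[ya0 /bdP[yY H']].
  apply/bdP; split=> //; case: H' => [|[w wY yw]]; [by left|right; exists w => //].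
  rewrite /e2 yw (negbTE ya0) /= (negbTE (_ : w != a0)) //.
  by apply: contraNneq wY => ->; apply: (subsetP X2Y); apply: (subsetP XX2).
have c1 : #|z |: (bd e N X :\ a0)| = #|bd e N X|.
  rewrite cardsU1 !inE (negbTE zX) /= !andbF /= (cardsD1 a0 (bd e N X)) a0X //.
(* Losing [a0] does no harm: it is not in the boundary of [X'], and for any other [Y] the boundary
   is larger than that of [X]. *)
have F3 Y : X2 \subset Y -> Y \subset X' -> #|bd e N X| <= #|bd e2 N Y|.
  move=> X2Y YX'; apply: leq_trans (subset_leq_card (F2 Y X2Y YX')).
  have XY := subset_trans XX2 X2Y.
  have [E|nE] := eqVneq Y X'.
    rewrite E; have -> : bd e N X' :\ a0 = bd e N X'.
      by apply/setP=> y; rewrite in_setD1; case: eqP => // ->; rewrite (negbTE a0X').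
    exact: H.
  have XpY : X \proper Y.
    by apply/properP; split=> //; exists z => //; apply: (subsetP X2Y); apply: setU11.
  have YpX' : Y \proper X' by rewrite properEneq nE.
  have /negbT := noY Y; rewrite [_ Y]/= XpY YpX' -ltnNge => lt.
  rewrite (cardsD1 a0 (bd e N Y)) in lt.
  by move: lt; case: (a0 \in bd e N Y); rewrite ?add1n ?add0n // => /ltnW.
have c2 := subset_leq_card F1; rewrite c1 in c2.
have E2 : bd e2 N X2 = z |: (bd e N X :\ a0).
  by apply/eqP; rewrite eqEcard F1 c1 F3.
have m2 : #|X' :\: X2| < m.
  apply: leq_trans mX; apply: proper_card; apply/properP; split; first exact: setDS.
  by exists z; rewrite !inE ?eqxx // zX zX'.
have [|P [L D]] := IH e2 X2 X' m2 e2s X2X'.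
  by move=> Y X2Y YX'; apply: leq_trans c2 (F3 _ _ _).
have zb : z \in bd e2 N X2 by rewrite E2 setU11.
have bb a : a \in bd e N X -> a != a0 -> a \in bd e2 N X2.
  by move=> aX aa0; rewrite E2 !inE aa0; move: aX; rewrite inE => ->; rewrite orbT.
have bX' : bd e2 N X' \subset bd e N X'.
  apply/subsetP=> y /bdP[yX H']; apply/bdP; split=> //.
  by case: H' => [|[w wX yw]]; [left|right; exists w => //; apply: e2e].
have DX2 : X' :\: X2 \subset X' :\: X by apply: setDS.
exists (fun a => if a == a0 then a0 |: P z else P a); split.
  move=> a aX; case: eqP => [->|/eqP aa0].
    have [zP cP sP [b bP bb']] := L z zb; split.
    - exact: setU11.
    - apply: (connectedU_edge (x := a0) (y := z)) => //; last exact: set11.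
        exact: connected1.
      exact: connected_sub_rel cP.
    - apply: setUS; apply: subset_trans sP _; apply/subUsetP; split=> //.
      by rewrite sub1set !inE zX.
    - by exists b; [rewrite inE bP orbT | apply: (subsetP bX')].
  have [aP cP sP [b bP bb']] := L a (bb _ aX aa0); split=> //.
  - exact: connected_sub_rel cP.
  - by apply: subset_trans sP _; apply: setUS.
  - by exists b => //; apply: (subsetP bX').
have D0 b : b \in bd e N X -> b != a0 -> [disjoint a0 |: P z & P b].
  move=> bX ba0; have [bP cP sP _] := L b (bb _ bX ba0).
  have zP : [disjoint P z & P b].
    apply: D => //; first exact: bb.
    by apply: contraNneq zX => ->; apply: (subsetP (bd_sub e N X)).
  rewrite -setI_eq0 setIUl setU_eq0 !setI_eq0 zP andbT disjoints1; apply/negP=> /(subsetP sP).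
  by rewrite !inE eq_sym (negbTE ba0) a0inX /= orbT.
move=> a b aX bX ab; case: eqP => [E|/eqP aa0]; case: eqP => [E'|/eqP ba0].
- by rewrite E E' eqxx in ab.
- exact: D0.
- by rewrite disjoint_sym; apply: D0.
- by apply: D => //; apply: bb.
Qed.

End Boundary.

(** * Trees with branch sets meeting a prescribed set *)

Section TreeModel.
Variables (V : finType) (e : rel V) (par : nat -> nat).

(* The branch sets of a minor model of the tree on [0, ..., i-1] in which [par j]
   is the parent of [j > 0]. *)
Definition tree_model i (b : nat -> {set V}) :=
  [/\ forall j, j < i -> connected_in e (b j),
      forall j k, j < i -> k < i -> j != k -> [disjoint b j & b k] &
      forall j, 0 < j < i -> exists u v, [&& u \in b j, v \in b (par j) & e u v]].

Definition rooted_model i (X R : {set V}) b (r : nat -> V) :=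
  tree_model i b /\ forall j, j < i -> [/\ b j \subset X, r j \in b j & r j \in R].

Lemma rooted_inj i X R b r j k : rooted_model i X R b r ->
  j < i -> k < i -> j != k -> r j != r k.
Proof.
move=> [[_ D _] H] ji ki jk; apply/eqP=> E.
have [_ rj _] := H j ji; have [_ rk _] := H k ki.
by move/disjoint_setI0/setP/(_ (r j)): (D _ _ ji ki jk); rewrite !inE rj E rk.
Qed.

(** The branch sets lie in [X] and [P a] meets [X] at most in [a], so [P (r j)] can meet no branch
    set but [b j]. *)
Lemma rooted_extend i X (R : {set V}) b r (P : V -> {set V}) : symmetric e ->
  (forall j, 0 < j -> par j < j) -> rooted_model i X R b r ->
  (forall a, a \in R -> [/\ a \in P a, connected_in e (P a) & P a \subset a |: ~: X]) ->
  (forall a c, a \in R -> c \in R -> a != c -> [disjoint P a & P c]) ->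
  tree_model i (fun j => b j :|: P (r j)).
Proof.
move=> es hp M HP DP; have [[cb D A] H] := M; split.
- move=> j ji; have [_ rj rR] := H j ji; have [aP cP _] := HP _ rR.
  by apply: connectedU rj aP => //; apply: cb.
- have X12 j k x : j < i -> k < i -> j != k -> x \in b j -> x \in P (r k) -> False.
    move=> ji ki jk xb xP; have [bX _ _] := H j ji; have [_ rk rR] := H k ki.
    have [_ _ /subsetP/(_ x xP)] := HP _ rR.
    rewrite !inE (subsetP bX) // orbF => /eqP E; subst x.
    by move/disjoint_setI0/setP/(_ (r k)): (D _ _ ji ki jk); rewrite !inE xb rk.
  move=> j k ji ki jk; apply/pred0P=> x; apply/negbTE/negP; rewrite /= !inE.
  have kj : k != j by rewrite eq_sym.
  case/andP=> /orP[xa|xa] /orP[xb|xb]; first 1 [idtac|exact: (X12 j k x)|exact: (X12 k j x)].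
    by move/disjoint_setI0/setP/(_ x): (D _ _ ji ki jk); rewrite !inE xa xb.
  have [_ _ rj] := H j ji; have [_ _ rk] := H k ki.
  by move/disjoint_setI0/setP/(_ x): (DP _ _ rj rk (rooted_inj M ji ki jk)); rewrite !inE xa xb.
- move=> j ji; have [u [v /and3P[uj vj uv]]] := A j ji.
  by exists u, v; rewrite !inE uj vj uv.
Qed.

End TreeModel.

(** * Excluding a forest relative to a set of vertices *)

Section RelativePathwidth.
Variables (V : finType) (e : rel V) (N : {set V}) (n : nat).
Hypothesis es : symmetric e.
Implicit Types X Y Z : {set V}.
Local Notation bdy := (bd e set0).

(** Chains of steps encode relative path decompositions: a step may add any number of vertices, but
    at most [n] of them from [N]. *)
Definition step (X X' : {set V}) :=
  [&& X \subset X', #|bdy X'| <= n & #|N :&: (X' :\: X)| <= n].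

Definition adm := connect step set0.

Lemma adm_ind (P : {set V} -> Prop) : P set0 ->
  (forall X X', adm X -> P X -> step X X' -> P X') -> forall X, adm X -> P X.
Proof.
move=> P0 Ps X /connectP[p pp ->].
suff: P (last set0 p) /\ adm (last set0 p) by case.
elim/last_ind: p pp => [|p z IH]; first by split=> //; apply: connect0.
rewrite rcons_path last_rcons => /andP[/IH[Pl al] lz]; split; first exact: Ps lz.
exact: connect_trans al (connect1 lz).
Qed.

Lemma adm_step X X' : adm X -> step X X' -> adm X'.
Proof. by move=> aX s; apply: connect_trans aX (connect1 s). Qed.

(** Intersect the chain leading to [X'] with [Y]. For [Z] in the chain, the boundary of [Z :|: Y] is
    at least as large as that of [Y], so by submodularity the boundary of [Z :&: Y] is at most as
    large as that of [Z]. *)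
Lemma adm_uncross X Y X' : X \subset Y -> Y \subset X' -> adm X' ->
  (forall Z, X \subset Z -> Z \subset X' -> #|bdy Y| <= #|bdy Z|) -> adm Y.
Proof.
move=> XY YX' aX' H; rewrite -(setIidPr YX').
suff K Z : adm Z -> Z \subset X' -> adm (Z :&: Y) by apply: K.
move: Z; apply: adm_ind => [_|Z Z' aZ IH /and3P[ZZ' bZ' nZ'] Z'X'].
  by rewrite set0I; apply: connect0.
apply: adm_step (IH (subset_trans ZZ' Z'X')) _; apply/and3P; split.
- exact: setSI.
- apply: leq_trans bZ'; have := bd_submod e set0 Z' Y.
  have : #|bdy Y| <= #|bdy (Z' :|: Y)|.
    by apply: H; [apply: subset_trans XY _; apply: subsetUr | apply/subUsetP].
  lia.
- apply: leq_trans nZ'; apply/subset_leq_card/subsetP=> x; rewrite !inE.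
  by case: (x \in Y); rewrite ?andbF // !andbT.
Qed.

Lemma adm_maximal i X : adm X -> #|bdy X| <= i ->
  exists X', [/\ adm X', X \subset X', #|bdy X'| <= i &
    forall Y, adm Y -> X' \proper Y -> i < #|bdy Y|].
Proof.
move=> aX bX.
have P0 : [&& adm X, X \subset X & #|bdy X| <= i] by rewrite aX subxx.
pose P := fun Z => [&& adm Z, X \subset Z & #|bdy Z| <= i].
case: (arg_maxnP (P := P) (fun Z => #|Z|) P0) => X' /and3P[aX' XX' bX'] mX'.
exists X'; split=> // Y aY X'Y; rewrite ltnNge; apply/negP=> bY.
have := mX' Y; rewrite /P /= aY bY (subset_trans XX' (proper_sub X'Y)) => /(_ isT).
by rewrite /= leqNgt (proper_card X'Y).
Qed.

(** Among the sets between [X1] and [X'], one of smallest boundary is admissible by uncrossing, so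
    it has more than [i] boundary vertices and Menger's theorem applies. *)
Lemma link_maximal i X X1 X' : adm X' -> X \proper X1 -> X1 \subset X' -> #|bdy X1| <= i.+1 ->
  (forall Y, adm Y -> X \proper Y -> i < #|bdy Y|) ->
  exists P, linkage e set0 X1 X' P.
Proof.
move=> aX' XX1 X1X' bX1 mX; apply: menger => // Y X1Y YX'.
apply: leq_trans bX1 _.
have P0 : (X1 \subset X') && (X' \subset X') by rewrite X1X' subxx.
pose P := fun Z => (X1 \subset Z) && (Z \subset X').
case: (arg_minnP (P := P) (fun Z => #|bdy Z|) P0) => Z /andP[X1Z ZX'] mZ.
apply: leq_trans (mZ Y _); last by rewrite /P X1Y YX'.
apply: mX; last exact: proper_sub_trans XX1 X1Z.
by apply: adm_uncross X1Z ZX' aX' _ => W X1W WX'; apply: mZ; rewrite /P X1W WX'.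
Qed.

Variable par : nat -> nat.
Hypothesis hpar : forall j, 0 < j -> par j < j.
Hypothesis nadm : ~~ adm setT.

(** A new branch set starts as a vertex [y] outside [X] adjacent to the root of its parent. The
    boundary of [y |: X] is then linked to that of a maximal admissible superset, and the roots move
    along the links. *)
Lemma rooted_stage i : i <= n -> exists X b r,
  [/\ adm X, #|bdy X| = i, forall Y, adm Y -> X \proper Y -> i < #|bdy Y| &
      rooted_model e par i X (bdy X) b r].
Proof.
elim: i => [_|i IH iN].
  have [|X [aX _ bX mX]] := @adm_maximal 0 set0 (connect0 _ _); first by rewrite bd_set0 cards0.
  have [z _] : exists z, z \notin X.
    apply/existsP; apply: contraR nadm; rewrite negb_exists => /forallP H.
    suff -> : setT = X by [].
    by apply/setP=> z; rewrite inE; have := H z; rewrite negbK => ->.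
  exists X, (fun=> set0), (fun=> z); split=> //; last by split=> //; split=> // j; rewrite ltn0 andbF.
  by apply/eqP; rewrite -leqn0.
have [X [b [r [aX bX mX M]]]] := IH (ltnW iN).
have [y yX yA] : exists2 y, y \notin X & 0 < i -> exists2 x, x \in b (par i) & e x y.
  case: (posnP i) => [->|i0].
    have : X != setT by apply: contraNneq nadm => <-.
    by rewrite -subTset => /subsetPn[y _ yX]; exists y.
  have [_ rb /bdP[_ [|[z zX xz]]]] := M.2 _ (hpar i0); first by rewrite inE.
  by exists z => // _; exists (r (par i)).
pose X1 := y |: X.
have XX1 : X \proper X1.
  by apply/properP; split; [exact: subsetUr | exists y; rewrite ?setU11].
have sX1 : bdy X1 \subset y |: bdy X.
  apply/subsetP=> x /bdP[]; rewrite !inE => /orP[->//|xX] [//|[z]].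
  rewrite !inE negb_or => /andP[_ zX] xz; apply/orP; right; rewrite xX /=.
  by apply/existsP; exists z; rewrite zX.
have c1 : #|y |: bdy X| = i.+1.
  by rewrite cardsU1 bX (contra (subsetP (bd_sub e set0 X) y)).
have bX1 : #|bdy X1| <= i.+1 by rewrite -c1; apply: subset_leq_card.
have aX1 : adm X1.
  apply: adm_step aX _; apply/and3P; split; first exact: subsetUr.
    exact: leq_trans bX1 iN.
  apply: leq_trans (leq_trans _ iN); first exact: subset_leq_card (subsetIr _ _).
  apply: (@leq_trans #|[set y]|); last by rewrite cards1.
  by apply/subset_leq_card/subsetP=> x; rewrite !inE; case: eqP => //= _; case: (x \in X).
(* Since [X] is maximal, [bdy X1] has more than [i] vertices and so contains all [i.+1]
   candidates. *)
have E1 : bdy X1 = y |: bdy X by apply/eqP; rewrite eqEcard sX1 c1 mX.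
have [X' [aX' X1X' bX' mX']] := adm_maximal aX1 bX1.
have [P [L D]] := link_maximal aX' XX1 X1X' bX1 mX.
have XX' : X \proper X' := proper_sub_trans XX1 X1X'.
pose b1 j := if j < i then b j else [set y].
pose r1 j := if j < i then r j else y.
have M1 : rooted_model e par i.+1 X1 (bdy X1) b1 r1.
  have [[cb Db A] H] := M.
  have yb j : j < i -> y \notin b j.
    by move=> ji; have [bjX _ _] := H j ji; apply: contra yX; apply: subsetP.
  split; first split.
  - by move=> j _; rewrite /b1; case: ltnP => [/cb//|_]; apply: connected1.
  - move=> j k; rewrite !ltnS /b1 => ji ki jk; case: ltnP => j1; case: ltnP => k1.
    + exact: Db.
    + by rewrite disjoint_sym disjoints1 yb.
    + by rewrite disjoints1 yb.
    + by case/eqP: jk; lia.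
  - move=> j /andP[j0]; rewrite ltnS leq_eqVlt /b1 => /orP[/eqP E|ji].
      subst j; rewrite ltnn hpar //; have [x xb xy] := yA j0.
      by exists y, x; rewrite set11 xb es xy.
    by rewrite ji (ltn_trans (hpar j0) ji); apply: A; rewrite j0.
  move=> j _; rewrite /b1 /r1 E1; case: ltnP => [ji|_].
    have [bjX rb rX] := H j ji; split=> //; last by rewrite inE rX orbT.
    exact: subset_trans bjX (subsetUr _ _).
  by rewrite sub1set !inE eqxx.
have [g Hg] : exists g : V -> V, forall a, a \in bdy X1 -> g a \in P a /\ g a \in bdy X'.
  apply: (fin_all_exists (P := fun a c => a \in bdy X1 -> c \in P a /\ c \in bdy X')) => a.
  by have [/L[_ _ _ [c ? ?]]|] := boolP (a \in bdy X1); [exists c | exists a].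
exists X', (fun j => b1 j :|: P (r1 j)), (fun j => g (r1 j)); split=> //.
  by apply/eqP; rewrite eqn_leq bX' mX.
split.
  apply: rooted_extend M1 _ _ => //.
  move=> a /L[aP cP sP _]; split=> //; apply: subset_trans sP _; apply: setUS.
  by apply/subsetP=> x; rewrite !inE => /andP[].
move=> j ji; have [bX1' _ rX] := M1.2 j ji; have [gP gX] := Hg _ rX.
have [_ _ sP _] := L _ rX.
split=> //; last by rewrite inE gP orbT.
apply/subUsetP; split; first exact: subset_trans X1X'.
apply: subset_trans sP _; apply/subUsetP; split; last exact: subsetDl.
by rewrite sub1set (subsetP X1X') // (subsetP (bd_sub e set0 X1)).
Qed.

(* Diestel's argument for excluding a forest, with every branch set forced to meet [N]. *)
Lemma rooted_tree_model : exists b, tree_model e par n b /\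
  forall j, j < n -> exists2 x, x \in b j & x \in N.
Proof.
have [X [b [r [aX bX mX M]]]] := rooted_stage (leqnn n).
(* Without the interior vertices of [X], the boundary of [X] relative to [N2] is [bdy X]; that of
   [setT] is [N2] itself. *)
pose N2 := N :\: (X :\: bdy X).
have E2 : bd e N2 X = bdy X.
  apply/setP=> x; apply/bdP/bdP=> -[xX H]; split=> //.
    case: H => [|[z zX xz]]; last by right; exists z.
    by rewrite !inE xX andbT => /andP[]; rewrite negbK => /existsP[z /andP[zX xz]] _; right; exists z.
  by case: H => [|[z zX xz]]; [rewrite inE | right; exists z].
have [Y XY _|P [L D]] := @menger _ e N2 X setT es (subsetT _).
  (* The vertices of [N] in [Y :\: X] count in the boundary of [Y]. If that boundary had fewer than
     [n] vertices, [Y] would be one step away from [X], against maximality. *)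
  rewrite E2 bX leqNgt; apply/negP=> lt.
  have sY : step X Y.
    apply/and3P; split=> //; apply: leq_trans (ltnW lt); apply/subset_leq_card/subsetP=> x.
      by case/bdP=> xY [|[z zX xz]]; [rewrite inE | apply/bdP; split=> //; right; exists z].
    rewrite !inE => /and3P[xN xX xY]; rewrite xY /= xN (negbTE xX) /= ?andbF //.
  have aY := adm_step aX sY.
  have [E|nE] := eqVneq X Y; first by rewrite -E E2 bX ltnn in lt.
  have XpY : X \proper Y by rewrite properEneq nE.
  case/and3P: sY => _ bY _.
  by have := mX Y aY XpY; rewrite ltnNge bY.
exists (fun j => b j :|: P (r j)); split.
  rewrite E2 in L D; apply: rooted_extend M _ _ => //.
  by move=> a /L[aP cP sP _]; split=> //; rewrite -setTD.
move=> j ji; have [_ _ rX] := M.2 j ji.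
rewrite -E2 in rX; have [_ _ _ [c cP /bdP[_ [cN|[z]]]]] := L _ rX; last by rewrite inE.
by exists c; [rewrite inE cP orbT | move: cN; rewrite inE => /andP[]].
Qed.

End RelativePathwidth.

(** * Core decompositions *)

Section Label.
Variables (V : finType) (e : rel V) (N : {set V}) (n : nat).

(** The label of [v] is the index of the step that adds [v], so the sets of the chain are the
    sublevel sets of [s]. *)
Lemma adm_label : adm e N n setT -> exists s : V -> nat, forall j,
  #|bd e set0 [set v | s v <= j]| <= n /\ #|[set v in N | s v == j]| <= n.
Proof.
pose Q (X : {set V}) := exists s m, [/\ forall v, (v \in X) = (s v < m), forall v, s v <= m,
  forall j, #|bd e set0 [set v | s v <= j]| <= n &
  forall j, j < m -> #|[set v in N | s v == j]| <= n].
suff H X : adm e N n X -> Q X.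
  move=> /H[s [m [sm _ s1 s2]]]; exists s => j; split=> //.
  have [/s2//|mj] := ltnP j m.
  rewrite (_ : [set _ in _ | _] = set0) ?cards0 //; apply/setP=> v; rewrite !inE.
  by apply/negbTE/negP=> /andP[_ /eqP E]; have := sm v; rewrite inE E; lia.
move: X; apply: adm_ind => [|X X' aX [s [m [sm mm s1 s2]]] /and3P[XX' bX' nX']].
  exists (fun=> 0), 0; split=> // [v|j]; first by rewrite inE.
  by rewrite [X in bd e set0 X](_ : _ = setT) ?bd_setT ?cards0.
have sX v : v \notin X -> s v = m by rewrite sm => H; have := mm v; lia.
exists (fun v => if v \in X then s v else if v \in X' then m else m.+1), m.+1; split.
- move=> v; case: (boolP (v \in X)) => [vX|_].
    by rewrite (subsetP XX') // ltnS mm.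
  by case: (v \in X'); rewrite ?ltnS ?leqnn ?ltnn.
- move=> v; case: (v \in X); first by apply: leqW.
  by case: (v \in X').
- move=> j; case: (ltngtP j m) => jm.
  + rewrite [X in bd e set0 X](_ : _ = [set v | s v <= j]) //; apply/setP=> v; rewrite !inE.
    case: (boolP (v \in X)) => // /sX ->; case: (v \in X'); lia.
  + rewrite [X in bd e set0 X](_ : _ = setT) ?bd_setT ?cards0 //; apply/setP=> v; rewrite !inE.
    by case: (v \in X); [have := mm v; lia | case: (v \in X'); lia].
  + subst j; rewrite [X in bd e set0 X](_ : _ = X') //; apply/setP=> v; rewrite !inE.
    case: (boolP (v \in X)) => [/(subsetP XX')->|_]; first by rewrite mm.
    by case: (v \in X'); rewrite ?leqnn ?ltnn.
- move=> j; rewrite ltnS leq_eqVlt => /orP[/eqP->|jm].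
    apply: leq_trans nX'; apply/subset_leq_card/subsetP=> v; rewrite !inE => /andP[-> /=].
    case: (boolP (v \in X)) => [|_]; first by rewrite sm => ? /eqP E; lia.
    by case: (v \in X') => // /eqP; lia.
  apply: leq_trans (s2 j jm); apply/subset_leq_card/subsetP=> v; rewrite !inE => /andP[-> /=].
  by case: (boolP (v \in X)) => // _; case: (v \in X') => /eqP; lia.
Qed.

End Label.

Section Core.
Variables (V : finType) (e : rel V).
Hypothesis es : symmetric e.
Implicit Types (D A K Y : {set V}) (s t : V -> nat).
Local Notation bdy := (bd e set0).

(* A path decomposition of [D] by intervals [s v, t v], in which the vertices outside the core
   [A] occupy a single position; only the core part of the bags has bounded size. *)
Definition core_decomp D A s t q :=
  [/\ A \subset D, forall v, v \in D -> s v <= t v,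
      forall u v, u \in D -> v \in D -> e u v -> s u <= t v,
      forall v, v \in D -> v \notin A -> t v = s v &
      forall j, #|[set v in A | s v <= j <= t v]| <= q].

(** The core consists of the boundary and of the vertices with a later neighbour, and [t v] is the
    last position of [v] and its neighbours in [D]. A core vertex occupying [j] is a boundary vertex
    labelled [j], or has a neighbour beyond [j], or is labelled below [j] and has a neighbour from
    [j] on. Each kind contributes at most [n]. *)
Lemma core_of_label D n s :
  (forall j, #|bd (restr e D) set0 [set v | s v <= j]| <= n /\
             #|[set v in bdy D | s v == j]| <= n) ->
  exists A t, core_decomp D A s t (3 * n) /\ bdy D \subset A.
Proof.
move=> H.
pose A := [set v in D | (v \in bdy D) || [exists u in D, e v u && (s v < s u)]].
pose t v := maxn (s v) (\max_(u in D | e v u) s u).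
have tP v u : u \in D -> e v u -> s u <= t v.
  move=> uD vu; rewrite /t leq_max; apply/orP; right.
  by apply: (@leq_bigmax_cond _ _ s u); rewrite uD.
have st v : s v <= t v by rewrite leq_maxl.
have AE v : (v \in A) = (v \in D) && ((v \in bdy D) || [exists u in D, e v u && (s v < s u)]).
  by rewrite inE.
have sub j v : v \in A -> s v <= j <= t v ->
  [|| v \in [set v in bdy D | s v == j], v \in bd (restr e D) set0 [set v | s v <= j] |
      (0 < j) && (v \in bd (restr e D) set0 [set v | s v <= j.-1])].
  rewrite AE => /andP[vD vA] /andP[sj jt].
  have [E|nE] := eqVneq (s v) j.
    case/orP: vA => [vN|/existsP[u /andP[uD /andP[vu su]]]].
      by apply/or3P; apply: Or31; rewrite inE vN E eqxx.
    apply/or3P; apply: Or32; apply/bdP; rewrite inE sj; split=> //; right; exists u.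
      by rewrite inE -ltnNge -E.
    by rewrite /restr vu vD uD.
  have lt : s v < j by rewrite ltn_neqAle nE.
  apply/or3P; apply: Or33; rewrite (leq_ltn_trans _ lt) //=.
  have [u /andP[uD vu] ju] : exists2 u, (u \in D) && e v u & j <= s u.
    move: jt; rewrite /t leq_max leqNgt lt /= => jt.
    have P0 : 0 < \max_(u in D | e v u) s u by lia.
    have /(eq_bigmax_cond s) : 0 < #|[pred u | (u \in D) && e v u]|.
      rewrite lt0n; apply: contraTneq P0 => /card0_eq P0.
      by rewrite big_pred0 // => u; have := P0 u; rewrite !inE.
    by case=> u; rewrite inE => uP E; exists u; rewrite // -E.
  apply/bdP; rewrite inE; split; first lia.
  by right; exists u; [rewrite inE; lia | rewrite /restr vu vD uD].
exists A, t; split; last first.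
  by apply/subsetP=> v vb; rewrite AE vb (subsetP (bd_sub e set0 D)).
split=> //.
- by apply/subsetP=> v; rewrite AE => /andP[].
- by move=> u v uD vD uv; apply: tP; rewrite // es.
- move=> v vD vA; apply/eqP; rewrite eqn_leq st andbT geq_max leqnn /=.
  apply/bigmax_leqP=> u /andP[uD vu]; rewrite leqNgt; apply: contra vA => lt.
  rewrite AE vD; apply/orP; right; apply/existsP; exists u.
  by rewrite uD vu.
- move=> j; pose B0 := [set v in bdy D | s v == j].
  pose B1 := bd (restr e D) set0 [set v | s v <= j].
  pose B2 := if 0 < j then bd (restr e D) set0 [set v | s v <= j.-1] else set0.
  apply: (@leq_trans #|B0 :|: B1 :|: B2|).
    apply/subset_leq_card/subsetP=> v; rewrite inE => /andP[vA /(sub j v vA)].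
    by rewrite !in_setU -/B0 -/B1 /B2 => /or3P[->|->|/andP[-> ->]]; rewrite ?orbT.
  have := leq_card_setU (B0 :|: B1) B2; have := leq_card_setU B0 B1.
  have [h1 h0] := H j; have h2 : #|B2| <= n.
    by rewrite /B2; case: (0 < j); rewrite ?cards0 //; case: (H j.-1).
  move=> [c1 _] [c2 _]; apply: leq_trans c2 _.
  move: h1 h0 h2 c1; rewrite -/B0 -/B1.
  move: #|B0| #|B1| #|B2| #|B0 :|: B1| => a b c d; lia.
Qed.

Definition component D A v := [set z | connect (restr e (D :\: A)) v z].
Definition comps D A := [set component D A v | v in D :\: A].
Definition nb K := [set u | (u \notin K) && [exists v in K, e v u]].

Lemma nbP K u : reflect (u \notin K /\ exists2 v, v \in K & e v u) (u \in nb K).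
Proof.
rewrite inE; apply: (iffP andP) => -[uK].
  by case/existsP=> v /andP[vK vu]; split=> //; exists v.
by case=> v vK vu; split=> //; apply/existsP; exists v; rewrite vK.
Qed.

Lemma comps_sub D A K : K \in comps D A -> K \subset D :\: A.
Proof.
case/imsetP=> v vD ->; apply/subsetP=> z; rewrite inE => /connect_restr_mem[<-//|[]//].
Qed.

Lemma comps_comp D A K z : K \in comps D A -> z \in K -> K = component D A z.
Proof.
case/imsetP=> v vD ->; rewrite inE => vz; apply/setP=> w; rewrite !inE.
by rewrite (same_connect (restr_connect_sym (D :\: A) es) vz).
Qed.

Lemma comp_comps D A v : v \in D :\: A -> component D A v \in comps D A.
Proof. exact: imset_f. Qed.

Lemma mem_comp D A v : v \in component D A v.
Proof. by rewrite inE connect0. Qed.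

Lemma comps_nb D A K : bdy D \subset A -> K \in comps D A -> nb K \subset A.
Proof.
move=> bA KC; have /subsetP KD := comps_sub KC; apply/subsetP=> u /nbP[uK [v vK vu]].
have := KD v vK; rewrite inE => /andP[vA vD].
have uD : u \in D.
  apply/negPn/negP => uD; case/negP: vA; apply: (subsetP bA); apply/bdP; split=> //.
  by right; exists u.
apply/negPn/negP=> uA; case/negP: uK.
rewrite (comps_comp KC vK) inE; apply: connect1.
by rewrite /restr vu !inE uA uD vA vD.
Qed.

(** Vertices outside the core occupy a single position, so adjacent ones share it. *)
Lemma comps_const D A s t q K u v : core_decomp D A s t q -> K \in comps D A ->
  u \in K -> v \in K -> s u = s v.
Proof.
move=> [_ _ sE tE _] KC uK; rewrite (comps_comp KC uK) inE => /connectP[p].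
elim: p u {uK} => [|w p IH] u /=; first by move=> _ ->.
rewrite {1}/restr => /andP[/and3P[uw]]; rewrite !inE => /andP[uA uD] /andP[wA wD] wp El.
rewrite -(IH w wp El); apply/eqP; rewrite eqn_leq.
by rewrite -{1}(tE w) // sE //= -(tE u) // sE // es.
Qed.

(* The part of the graph seen from [D] can be contracted into a single apex. *)
Definition apexed D := exists Y, [/\ connected_in e Y, nb D \subset Y & [disjoint Y & D]].

(* If some neighbour of a hanging component [K] is not connected to the apex outside [K],
   the whole part that [K] cuts off from the apex is made to hang at the position of [K]. *)
Lemma core_shrink D A s t q : core_decomp D A s t q -> bdy D \subset A ->
  bdy D != set0 -> apexed D ->
  exists A' s' t', [/\ core_decomp D A' s' t' q, bdy D \subset A' &
    forall K, K \in comps D A' -> apexed K].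
Proof.
move=> + + b0 [Y [cY nY dY]].
have [v0 /bdP[v0D [|[y0 y0D vy0]]]] := set0Pn _ b0; first by rewrite inE.
have y0Y : y0 \in Y by apply: (subsetP nY); apply/nbP; split=> //; exists v0.
have [m] := ubnP #|A|; elim: m A s t => // m IH A s t; rewrite ltnS => Am HA bA.
pose Yc K := [set z | connect (restr e (~: K)) y0 z].
have [AD st sE tE cnt] := HA.
have YY K : K \in comps D A -> Y \subset Yc K.
  move=> /comps_sub KD; apply/subsetP=> z zY; rewrite inE.
  apply: connect_restr_sub (cY _ _ y0Y zY) => //; apply/subsetP=> w wY; rewrite inE.
  apply/negP=> /(subsetP KD); rewrite inE => /andP[_ wD].
  by move/disjoint_setI0/setP/(_ w): dY; rewrite !inE wY wD.
have dYc K : K \in comps D A -> [disjoint Yc K & K].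
  move=> /comps_sub KD; apply/pred0P=> z; apply/negbTE/negP; rewrite /= inE => /andP[yz zK].
  case: (connect_restr_mem yz) => [E|[_]]; last by rewrite inE zK.
  by move: (subsetP KD z zK); rewrite -E inE (negbTE y0D) andbF.
have [/forallP H|] := boolP [forall K in comps D A, nb K \subset Yc K].
  exists A, s, t; split=> // K KC; exists (Yc K); split; last exact: dYc.
    exact: connected_component.
  by have := H K; rewrite KC.
rewrite negb_forall => /existsP[K]; rewrite negb_imply => /andP[KC /subsetPn[r rK rY]].
have KD := comps_sub KC.
have ext u v : u \notin Yc K -> v \in Yc K -> e v u -> u \in K.
  move=> uY; rewrite inE => yv vu; apply/negPn/negP=> uK; case/negP: uY; rewrite inE.
  apply: (connect_trans yv); apply: connect1; rewrite /restr vu !inE uK andbT.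
  case: (connect_restr_mem yv) => [<-|[_]]; last by rewrite inE.
  by apply/negP=> /(subsetP KD); rewrite inE (negbTE y0D) andbF.
have [_ [k0 k0K _]] := nbP _ _ rK.
(* All that the apex cannot reach around [K], and [K] itself, moves to the position [s k0] of
   [K]. *)
pose s' v := if v \in Yc K then s v else s k0.
pose t' v := if v \in Yc K then t v else s k0.
have sK u : u \in K -> s u = s k0 by move=> uK; apply: comps_const HA KC uK k0K.
have tK u : u \in K -> t u = s k0.
  by move=> uK; rewrite -(sK u uK); have := subsetP KD u uK; rewrite inE => /andP[uA uD]; apply: tE.
(* The core becomes smaller because it loses [r], a neighbour of [K] that is cut off. *)
apply: (IH (A :&: Yc K) s' t').
- apply: leq_trans Am; apply: proper_card; apply/properP; split; first exact: subsetIl.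
  by exists r; [apply: (subsetP (comps_nb bA KC)) | rewrite inE (negbTE rY) andbF].
- split.
  + by apply: subset_trans AD; apply: subsetIl.
  + by move=> v vD; rewrite /s' /t'; case: ifP => // _; apply: st.
  + move=> u v uD vD uv; rewrite /s' /t'.
    case: (boolP (u \in Yc K)) => uY; case: (boolP (v \in Yc K)) => vY //.
    * exact: sE.
    * by rewrite -(tK v) ?sE // (ext v u).
    * by rewrite -(sK u) ?sE // (ext u v) // es.
  + move=> v vD; rewrite inE negb_and /t' /s'; case: (v \in Yc K) => //=.
    by rewrite orbF => vA; apply: tE.
  + move=> j; apply: leq_trans (cnt j); apply/subset_leq_card/subsetP=> v; rewrite 2!inE /s' /t'.
    by rewrite inE -andbA => /and3P[-> -> ->].
apply/subsetP=> v vb; rewrite inE (subsetP bA) //= inE.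
have vA := subsetP bA v vb; case/bdP: (vb) => vD [|[z zD vz]]; first by rewrite inE.
have zY : z \in Yc K by apply: (subsetP (YY K KC)); apply: (subsetP nY); apply/nbP; split=> //; exists v.
move: (zY); rewrite inE => yz; apply: (connect_trans yz); apply: connect1.
rewrite /restr es vz !inE /=; apply/andP; split.
  by apply/negP=> /(subsetP KD); rewrite inE (negbTE zD) andbF.
by apply/negP=> /(subsetP KD); rewrite inE vA.
Qed.

(** Excludes minor models of the tree plus an apex adjacent to all its vertices; [Y] is the branch
    set of the apex. *)
Definition apex_tree_free (par : nat -> nat) n := forall Y b,
  connected_in e Y -> tree_model e par n b ->
  (forall j, j < n -> [disjoint b j & Y] /\ exists x y, [&& x \in b j, y \in Y & e x y]) -> False.

(** Either a chain relative to the boundary reaches all of [D] and yields a core to be shrunk, or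
    [D] contains a tree model whose branch sets all meet the boundary, which the set [Y] behind [D]
    completes to an excluded model. *)
Lemma core_exists par n D : (forall j, 0 < j -> par j < j) -> 0 < n ->
  apex_tree_free par n -> D != set0 -> apexed D ->
  exists A s t, [/\ core_decomp D A s t (3 * n), bdy D \subset A, A != set0 &
    forall K, K \in comps D A -> apexed K].
Proof.
move=> hp n0 free D0 apD.
(* With empty boundary any vertex [v] of [D] forms a core: a component has no neighbour other than
   [v], so [[set v]] is its apex. *)
have [b0|b0] := eqVneq (bdy D) set0.
  have [v vD] := set0Pn _ D0.
  exists [set v], (fun=> 0), (fun=> 0); split.
  - split=> //; first by rewrite sub1set.
    move=> j; apply: (@leq_trans #|[set v]|); last by rewrite cards1; lia.
    by apply/subset_leq_card/subsetP=> x; rewrite inE => /andP[].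
  - by rewrite b0 sub0set.
  - by apply/set0Pn; exists v; rewrite set11.
  move=> K KC; exists [set v]; split; first exact: connected1.
    by apply: comps_nb KC; rewrite b0 sub0set.
  rewrite disjoints1; apply/negP=> /(subsetP (comps_sub KC)).
  by rewrite !inE eqxx.
have [/adm_label[s sP]|nadm] := boolP (adm (restr e D) (bdy D) n setT).
  have [A [t [HA bA]]] := core_of_label sP.
  have [A' [s' [t' [HA' bA' cA']]]] := core_shrink HA bA b0 apD.
  exists A', s', t'; split=> //; apply: contraNneq b0 => E.
  by rewrite E subset0 in bA'.
have [b [Mb rb]] := rooted_tree_model (restr_sym D es) hp nadm.
have [Y [cY nY dY]] := apD.
have [cb Db Ab] := Mb.
have bD j : j < n -> b j \subset D.
  move=> jn; have [x xb /bdP[xD _]] := rb j jn; apply/subsetP=> y yb.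
  have : connect (restr e D) x y.
    by apply: connect_sub (cb j jn x y xb yb) => u v /and3P[uv _ _]; apply: connect1.
  by case/connect_restr_mem=> [<-|[]].
case: (free Y b cY).
  split=> // j jn.
    by apply: connected_sub_rel (cb j jn) => u v /and3P[].
  have [u [v /and3P[ub vb /and3P[uv _ _]]]] := Ab j jn.
  by exists u, v; rewrite ub vb.
move=> j jn; split.
  apply: disjointWl (bD j jn) _; by rewrite disjoint_sym.
have [x xb /bdP[xD [|[z zD xz]]]] := rb j jn; first by rewrite inE.
exists x, z; rewrite xb xz (subsetP nY) //; apply/nbP; split=> //; by exists x.
Qed.

End Core.

(** * Layered path decompositions *)

Section ParentTree.
Variables (X : finType) (par : X -> X) (rk : X -> nat).
Hypothesis rkP : forall x, par x != x -> rk (par x) < rk x.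

(* Roots are the fixpoints of [par]. *)
Definition ptree : rel X := fun x y => (x != y) && ((par x == y) || (par y == x)).

Lemma ptree_sym : symmetric ptree.
Proof. by move=> x y; rewrite /ptree eq_sym orbC. Qed.

Lemma ptree_irr : irreflexive ptree.
Proof. by move=> x; rewrite /ptree eqxx. Qed.

(** On a cycle, both neighbours of a vertex of largest rank would be its parent. *)
Lemma ptree_acyclic S : ~ has_cycle_in ptree S.
Proof.
case=> s [us ss _ cs].
have [x xs mx] : exists2 x, x \in s & forall y, y \in s -> rk y <= rk x.
  have [x0 x0s] : exists x0, x0 \in s by case: s ss {us cs} => // y s _; exists y; rewrite mem_head.
  by case: (arg_maxnP (P := mem s) rk x0s) => x xs H; exists x.
case: (rot_to xs) => i p Ep.
have up : uniq (x :: p) by rewrite -Ep rot_uniq.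
have cp : cycle ptree (x :: p) by rewrite -Ep rot_cycle.
have sp : 1 < size p by rewrite -ltnS -[(size p).+1]/(size (x :: p)) -Ep size_rot.
have mp y : y \in p -> rk y <= rk x.
  by move=> yp; apply: mx; rewrite -(mem_rot i) Ep inE yp orbT.
have nb y : y \in p -> ptree x y -> par x = y.
  move=> yp; rewrite /ptree => /andP[xy /orP[/eqP//|/eqP E]].
  have : par y != y by rewrite E.
  by move/rkP; rewrite E ltnNge mp.
case: p up cp sp mp nb {Ep} => [//|y p] /= up cp sp mp nb.
case: (lastP p) up cp sp mp nb => [//|{}p z] up cp _ mp nb.
move: cp; rewrite rcons_path last_rcons => /andP[xy /andP[_ zx]].
have E1 : par x = y by apply: nb => //; rewrite inE eqxx.
have E2 : par x = z by apply: nb; [rewrite inE mem_rcons inE eqxx orbT | rewrite ptree_sym].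
by move: up; rewrite -E1 E2 mem_rcons inE eqxx !andbF.
Qed.

(** Every vertex of [S] climbs along [par] within [S] to [t]; if [t] is not in [S] the climb cannot
    end, so [S] is empty. *)
Lemma ptree_connected (S : {set X}) t :
  (forall x, x \in S -> x != t -> par x \in S /\ par x != x) -> connected_in ptree S.
Proof.
move=> H; have [tS|tS] := boolP (t \in S); last first.
  move=> x y xS; have [m] := ubnP (rk x); elim: m x xS => // m IH x xS; rewrite ltnS => xm yS.
  have [|pS px] := H x xS; first by apply: contraNneq tS => <-.
  apply: connect_trans (IH _ pS _ yS); last exact: leq_trans (rkP px) xm.
  by apply: connect1; rewrite /restr /ptree eq_sym px eqxx xS.
apply: (connected_from (x := t) ptree_sym) => x.
have [m] := ubnP (rk x); elim: m x => // m IH x; rewrite ltnS => xm xS.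
have [->|xt] := eqVneq x t; first exact: connect0.
have [pS px] := H x xS xt.
apply: connect_trans (IH _ _ pS) _; first exact: leq_trans (rkP px) xm.
by apply: connect1; rewrite /restr /ptree px eqxx xS pS orbT.
Qed.

Lemma ptree_tree r : (forall x, x != r -> par x != x) -> is_tree ptree.
Proof.
move=> H; split; [exact: ptree_sym|exact: ptree_irr| |..].
- by apply/card_gt0P; exists r.
- by apply: (@ptree_connected _ r) => x _ xr; split; [rewrite inE | apply: H].
- exact: ptree_acyclic.
Qed.

End ParentTree.

Section Intervals.
Variable m : nat.

Definition pathpar (i : 'I_m.+1) : 'I_m.+1 := inord i.-1.

Lemma val_pathpar i : pathpar i = i.-1 :> nat.
Proof. by rewrite inordK // (leq_ltn_trans (leq_pred _)). Qed.

Lemma pathpar_neq i : (pathpar i != i) = (0 < i).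
Proof. by rewrite -val_eqE /= val_pathpar; apply/idP/idP; lia. Qed.

Lemma pathpar_lt i : pathpar i != i -> pathpar i < i.
Proof. by rewrite pathpar_neq val_pathpar; lia. Qed.

Lemma ptree_path : is_path_graph (ptree pathpar).
Proof.
split.
  by apply: (@ptree_tree _ _ _ pathpar_lt ord0) => x; rewrite pathpar_neq -val_eqE /= lt0n.
move=> x; apply: (@leq_trans #|[set pathpar x; inord x.+1]|); last by rewrite cards2; case: eqP.
apply/subset_leq_card/subsetP=> y; rewrite !inE => /andP[xy /orP[/eqP->|/eqP E]]; first by rewrite eqxx.
apply/orP; right; rewrite -val_eqE /=.
have y0 : 0 < y by rewrite -pathpar_neq E.
have E' : x.+1 = y by rewrite -E val_pathpar prednK.
by rewrite E' inordK.
Qed.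

Lemma interval_connected a b : connected_in (ptree pathpar) [set i : 'I_m.+1 | a <= i <= b].
Proof.
apply: (@ptree_connected _ _ _ pathpar_lt _ (inord a)) => x; rewrite inE => /andP[ax xb].
rewrite -val_eqE /= inordK; last exact: leq_ltn_trans (ltn_ord x).
by move=> xa; rewrite inE pathpar_neq val_pathpar; lia.
Qed.

Lemma interval_decomp (V : finType) (e : rel V) (A : {set V}) (s t : V -> nat) :
  (forall v, v \in A -> s v <= t v /\ s v <= m) ->
  (forall u v, u \in A -> v \in A -> e u v -> s u <= t v /\ s v <= t u) ->
  tree_decomp e A (ptree pathpar) (fun i => [set v in A | s v <= i <= t v]).
Proof.
move=> st eA; split.
- by move=> x; apply/subsetP=> v; rewrite inE => /andP[].
- move=> u v uA vA /(eA u v uA vA)[uv vu].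
  have [su mu] := st u uA; have [sv mv] := st v vA.
  exists (inord (maxn (s u) (s v))); rewrite !inE uA vA /= inordK; last by rewrite ltnS geq_max mu.
  by rewrite !leq_max !leqnn !geq_max ?orbT su sv uv vu.
- move=> v vA; have [sv mv] := st v vA.
  by exists (inord (s v)); rewrite inE vA inordK // leqnn.
- move=> v vA; rewrite (_ : [set _ | _] = [set i : 'I_m.+1 | s v <= i <= t v]); first exact: interval_connected.
  by apply/setP=> i; rewrite !inE vA.
Qed.

End Intervals.

(* Blocks of [M] consecutive positions inside blocks of [W]: a position determines its block. *)
Lemma block_pos W M a c l h x : h < M -> c * M + h < W ->
  a * W + (c * M + l) <= x <= a * W + (c * M + h) ->
  c = x %% W %/ M /\ l <= x %% W %% M <= h.
Proof.
move=> hM cW /andP[x1 x2]; pose y := x - (a * W + c * M).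
have E : x = a * W + (c * M + y) by rewrite /y; lia.
have yh : y <= h by rewrite /y; lia.
have yl : l <= y by rewrite /y; lia.
have yM : y < M := leq_ltn_trans yh hM.
have rW : c * M + y < W by apply: leq_ltn_trans cW; rewrite leq_add2l.
rewrite E modnMDl (modn_small rW) modnMDl (modn_small yM) yl yh.
by rewrite divnMDl ?(divn_small yM) ?addn0 //; apply: leq_trans yM.
Qed.

Record layout (V : finType) := Layout {
  lo : V -> nat; hi : V -> nat; lay : V -> nat; len : nat }.

Section Layered.
Variables (V : finType) (e : rel V) (par : nat -> nat) (n : nat).
Hypothesis es : symmetric e.
Hypothesis hpar : forall j, 0 < j -> par j < j.
Hypothesis n0 : 0 < n.
Hypothesis free : apex_tree_free e par n.

(** The boundary is put in layer [0] so that, after a shift by one, it is next to the core of an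
    enclosing set. *)
Definition good_layout (D : {set V}) (l : layout V) :=
  [/\ forall v, v \in D -> lo l v <= hi l v < len l,
      forall u v, u \in D -> v \in D -> e u v -> lo l u <= hi l v /\ lay l u <= (lay l v).+1,
      forall v, v \in bd e set0 D -> lay l v = 0 &
      forall x i, #|[set v in D | (lo l v <= x <= hi l v) && (lay l v == i)]| <= 3 * n].

(* The core vertices form layer [0]; the components of the rest, which are laid out recursively
   with their layers shifted by one, get disjoint blocks of positions next to the bag to
   which they are attached. *)
Lemma layered_layout D : apexed e D -> exists l, good_layout D l.
Proof.
have [m] := ubnP #|D|; elim: m D => // m IH D; rewrite ltnS => Dm apD.
have [->|D0] := eqVneq D set0.
  exists (Layout (fun=> 0) (fun=> 0) (fun=> 0) 0); split=> [v|u v|v|x i].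
  - by rewrite inE.
  - by rewrite inE.
  - by rewrite bd_set0 inE.
  - by rewrite (_ : [set _ in _ | _] = set0) ?cards0 //; apply/setP=> v; rewrite !inE.
have [A [s [t [HA bA A0 apK]]]] := core_exists es hpar n0 free D0 apD.
have [AD st sE tE cnt] := HA.
have [d dP] : exists d : {set V} -> layout V, forall K, K \in comps e D A -> good_layout K (d K).
  apply: (fin_all_exists (P := fun K l => K \in comps e D A -> good_layout K l)) => K.
  have [KC|_] := boolP (K \in comps e D A); last by exists (Layout (fun=> 0) (fun=> 0) (fun=> 0) 0).
  have [l lP] : exists l, good_layout K l; last by exists l.
  apply: IH; last exact: apK.
  apply: leq_trans Dm; apply: proper_card; apply/properP.
  have KD := comps_sub KC; split; first exact: subset_trans KD (subsetDl _ _).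
  have [a aA] := set0Pn _ A0; exists a; first exact: (subsetP AD).
  by apply/negP=> /(subsetP KD); rewrite inE aA.
pose kv v := component e D A v.
have kvC v : v \in D -> v \notin A -> kv v \in comps e D A.
  by move=> vD vA; apply: comp_comps; rewrite inE vA.
have kvm v : v \in kv v by apply: mem_comp.
(* Each position of the core decomposition becomes a block of [W] positions, in which the component
   [K] owns the [M] positions from [c K * M] on. The successor keeps [W] positive. *)
pose M := \max_K len (d K); pose c (K : {set V}) := nat_of_ord (enum_rank K).
pose W := (#|{set V}| * M).+1.
have MP K : len (d K) <= M by apply: (leq_bigmax K).
have kvP v : v \in D -> v \notin A ->
    [/\ lo (d (kv v)) v <= hi (d (kv v)) v, hi (d (kv v)) v < M &
        c (kv v) * M + hi (d (kv v)) v < W].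
  move=> vD vA; have [H _ _ _] := dP _ (kvC v vD vA).
  have /andP[lh hl] := H v (kvm v).
  have hM := leq_trans hl (MP _); split=> //.
  rewrite ltnS; apply: (@leq_trans ((c (kv v)).+1 * M)); first by rewrite mulSn addnC leq_add2r ltnW.
  by rewrite leq_mul2r ltn_ord orbT.
pose L v := if v \in A then 0 else (lay (d (kv v)) v).+1.
pose S v := s v * W + (if v \in A then 0 else c (kv v) * M + lo (d (kv v)) v).
pose T v := t v * W + (if v \in A then W.-1 else c (kv v) * M + hi (d (kv v)) v).
have SW v : v \in D -> S v < (s v).+1 * W.
  move=> vD; rewrite /S mulSn addnC ltn_add2r.
  by case: (boolP (v \in A)) => // vA; have [] := kvP v vD vA; lia.
have TW v : v \in D -> T v < (t v).+1 * W.
  move=> vD; rewrite /T mulSn addnC ltn_add2r.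
  by case: (boolP (v \in A)) => // vA; have [] := kvP v vD vA.
have ST v : v \in D -> S v <= T v.
  move=> vD; rewrite /S /T; apply: leq_add; first by rewrite leq_mul2r st // orbT.
  by case: (boolP (v \in A)) => // vA; rewrite leq_add2l; have [] := kvP v vD vA.
have kvE u v : u \in D -> v \in D -> u \notin A -> v \notin A -> e u v -> kv v = kv u.
  move=> uD vD uA vA uv; symmetry; apply: (comps_comp es (kvC u uD uA)).
  by rewrite /kv inE; apply: connect1; rewrite /restr uv !inE uA uD vA vD.
have bdK u v : u \in D -> u \notin A -> v \in A -> e u v -> u \in bd e set0 (kv u).
  move=> uD uA vA uv; apply/bdP; split; first exact: kvm.
  right; exists v => //; apply/negP=> /(subsetP (comps_sub (kvC u uD uA))).
  by rewrite inE vA.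
exists (Layout S T L ((\max_v t v).+1 * W)); split=> /=.
- move=> v vD; rewrite ST //=; apply: leq_trans (TW v vD) _.
  by rewrite leq_mul2r ltnS (leq_bigmax v) orbT.
- move=> u v uD vD uv; split.
    have suv := sE u v uD vD uv.
    have [vA|vA] := boolP (v \in A).
      rewrite -ltnS; apply: leq_trans (SW u uD) _; rewrite /T vA -addnS prednK //.
      by rewrite -mulSnr leq_mul2r ltnS suv orbT.
    have [uA|uA] := boolP (u \in A).
      by rewrite /S /T uA addn0; apply: leq_trans (leq_addr _ _); rewrite leq_mul2r suv orbT.
    rewrite /S /T (negbTE uA) (negbTE vA) (kvE u v) //; apply: leq_add.
      by rewrite leq_mul2r suv orbT.
    rewrite leq_add2l; have [_ H _ _] := dP _ (kvC u uD uA).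
    by have [] := H u v; rewrite // -(kvE u v).
  rewrite /L; case: (boolP (u \in A)) => // uA; case: (boolP (v \in A)) => vA.
    have [_ _ H _] := dP _ (kvC u uD uA); by rewrite H // (bdK u v).
  have [_ H _ _] := dP _ (kvC u uD uA).
  by rewrite ltnS (kvE u v) //; have [] := H u v; rewrite // -(kvE u v).
- by move=> v vb; rewrite /L (subsetP bA).
move=> x [|i].
  apply: leq_trans (cnt (x %/ W)); apply/subset_leq_card/subsetP=> v; rewrite !inE /L.
  case: (boolP (v \in A)) => vA; last by rewrite !andbF.
  rewrite /S /T vA addn0 andbT => /andP[vD /andP[sx xt]] /=.
  rewrite leq_divRL // sx /= -ltnS ltn_divLR //.
  by apply: leq_ltn_trans xt _; rewrite mulSn addnC ltn_add2r.
(* Only one component can have vertices at position [x], so layer [i.+1] there is contained in layer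
   [i] of a single bag of that component. *)
have key v : v \in D -> S v <= x <= T v -> v \notin A ->
    c (kv v) = x %% W %/ M /\ lo (d (kv v)) v <= x %% W %% M <= hi (d (kv v)) v.
  move=> vD + vA; rewrite /S /T (negbTE vA) tE //.
  by have [_ hM cW] := kvP v vD vA; apply: block_pos.
have LS v : L v == i.+1 -> v \notin A /\ lay (d (kv v)) v == i.
  by rewrite /L; case: (boolP (v \in A)).
have [->|/set0Pn[v0]] := eqVneq [set v in D | (S v <= x <= T v) && (L v == i.+1)] set0.
  by rewrite cards0.
rewrite inE => /and3P[v0D xv0 /LS[v0A _]].
have [c0 _] := key v0 v0D xv0 v0A.
have [_ _ _ H] := dP _ (kvC v0 v0D v0A).
apply: leq_trans (H (x %% W %% M) i); apply/subset_leq_card/subsetP=> v; rewrite inE.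
move=> /and3P[vD xv /LS[vA vi]]; have [cv rv] := key v vD xv vA.
have E : kv v = kv v0 by apply/enum_rank_inj/val_inj; rewrite /= -/(c _) -/(c _) cv c0.
by rewrite inE -{1}E kvm -E rv vi.
Qed.

End Layered.

Lemma layered_pw (G : sgraph) par n : (forall j, 0 < j -> par j < j) -> 0 < n ->
  apex_tree_free (gadj G) par n -> layered_pw_le G (3 * n).
Proof.
move=> hp n0 free.
have [|l [l1 l2 _ l4]] := layered_layout (@gsym G) hp n0 free (D := setT).
  (* Nothing lies outside the whole graph, so the empty set serves as apex. *)
  exists set0; split; first exact: connected0.
    by apply/subsetP=> u /nbP[]; rewrite inE.
  by rewrite -setI_eq0 set0I.
exists _, (ptree (@pathpar (len l))), (fun i : 'I_(len l).+1 => [set v in [set: gV G] | lo l v <= i <= hi l v]), (lay l); split.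
- exact: ptree_path.
- apply: interval_decomp => [v|u v] vT.
    by have /andP[lh hl] := l1 v vT; split=> //; apply: ltnW; apply: leq_ltn_trans hl.
  move=> uT uv; have [H1 _] := l2 u v vT uT uv.
  by have [] := l2 v u uT vT _; rewrite // gsym.
- move=> u v uv; have [_ ->] := l2 u v (in_setT _) (in_setT _) uv.
  by have [] := l2 v u (in_setT _) (in_setT _) _; rewrite // gsym.
move=> x i; apply: leq_trans (l4 x i); apply/subset_leq_card/subsetP=> v.
by rewrite !inE /= => /andP[-> ->].
Qed.

(** * Local pathwidth, and trees of bags *)

Lemma card_fibers_le (V : finType) (S : {set V}) (f : V -> nat) a m l :
  (forall v, v \in S -> a <= f v < a + m) ->
  (forall i, #|[set v in S | f v == i]| <= l) -> #|S| <= m * l.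
Proof.
elim: m S => [|m IH] S H fl.
  rewrite (_ : S = set0) ?cards0 //; apply/setP=> v; rewrite inE; apply/negbTE/negP=> /H.
  by rewrite addn0; lia.
rewrite -(cardsID [set v | f v == a + m] S) mulSn; apply: leq_add.
  by apply: leq_trans (fl (a + m)); apply/subset_leq_card/subsetP=> v; rewrite !inE.
apply: IH => [v|i].
  by rewrite !inE => /andP[fv /H]; lia.
apply: leq_trans (fl i); apply/subset_leq_card/subsetP=> v; rewrite !inE.
by case/andP=> /andP[_ ->] ->.
Qed.

Lemma card_bigcup_le (X V : finType) (W : {set X}) (B : X -> {set V}) w :
  (forall x, #|B x| <= w) -> #|\bigcup_(x in W) B x| <= #|W| * w.
Proof.
move=> Bw; apply: (@leq_trans (\sum_(x in W) #|B x|)).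
  elim/big_rec2: _ => [|x m S _ H]; first by rewrite cards0.
  by apply: leq_trans (leq_card_setU _ _) _; rewrite leq_add2l.
by rewrite -sum_nat_const; apply: leq_sum.
Qed.

Section LayeredToLocal.
Variable G : sgraph.

Lemma ball_layer (L : gV G -> nat) r v u : layering L -> u \in ball (gadj G) r v ->
  L u <= L v + r /\ L v <= L u + r.
Proof.
move=> HL; elim: r u => [|r IH] u /=; first by move/set1P->; rewrite addn0.
case/setUP => [/IH[]|]; first by lia.
rewrite inE => /existsP[x /andP[/IH[h1 h2] /HL/andP[]]]; lia.
Qed.

Lemma layered_local l v r : layered_pw_le G l ->
  pathwidth_le (gadj G) (ball (gadj G) r v) (2 * l * r + l).
Proof.
case=> X [eX [B [L [pX [_ Be Bv Bc] HL Bl]]]].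
exists X, eX, (fun x => B x :&: ball (gadj G) r v); split=> //.
  split.
  - by move=> x; apply: subsetIr.
  - move=> a b ab bb /(Be a b (in_setT _) (in_setT _))[x /andP[ax bx]].
    by exists x; rewrite !inE ax bx ab bb.
  - by move=> a ab; have [x ax] := Bv a (in_setT _); exists x; rewrite inE ax.
  - move=> a ab; rewrite (_ : [set _ | _] = [set x | a \in B x]); first exact: Bc.
    by apply/setP=> x; rewrite !inE ab andbT.
move=> x; apply: leqW; apply: (@leq_trans ((2 * r).+1 * l)); last by lia.
apply: (@card_fibers_le _ _ L (L v - r)).
  by move=> u; rewrite inE => /andP[_ /(ball_layer HL)[]]; lia.
move=> i; apply: leq_trans (Bl x i); apply/subset_leq_card/subsetP=> u; rewrite !inE.
by case/andP=> /andP[-> _] ->.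
Qed.

End LayeredToLocal.

(** * Connected sets in forests: intersections and the Helly property *)

Section Acyclic.
Variables (X : finType) (e : rel X).
Hypothesis es : symmetric e.

Lemma path_restr (S : {set X}) x p : path (restr e S) x p -> path e x p /\ {subset p <= S}.
Proof.
elim: p x => [|y p IH] x //= /andP[/and3P[xy _ yS] /IH[yp pS]]; rewrite xy yp; split=> //.
by move=> z; rewrite inE => /orP[/eqP->|/pS].
Qed.

Lemma longest_path (S : {set X}) : S != set0 -> exists x s,
  [/\ uniq (x :: s), {subset x :: s <= S}, path e x s &
      forall y t, uniq (y :: t) -> {subset y :: t <= S} -> path e y t -> size t <= size s].
Proof.
case/set0Pn=> x0 x0S.
pose P k := [exists x : X, exists t : k.-tuple X,
  [&& uniq (x :: t), all (mem S) (x :: t) & path e x t]].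
have P0 : exists k, P k.
  by exists 0; apply/existsP; exists x0; apply/existsP; exists [tuple]; rewrite /= x0S.
have Pb k : P k -> k <= #|X|.
  move=> /existsP[x /existsP[t /and3P[ut _ _]]]; apply: ltnW.
  have : size (x :: t) <= #|X| by rewrite -(card_uniqP ut) max_card.
  by rewrite /= size_tuple.
case: (ex_maxnP P0 Pb) => k /existsP[x /existsP[t /and3P[ut tS pt]]] mk.
exists x, t; split=> //; first exact/allP.
move=> y q uq qS pq; rewrite size_tuple; apply: mk.
apply/existsP; exists y; apply/existsP; exists (in_tuple q).
by apply/and3P; split=> //; apply/allP.
Qed.

Lemma acyclic_chord (S : {set X}) x p y : ~ has_cycle_in e S -> uniq (x :: rcons p y) ->
  {subset x :: rcons p y <= S} -> path e x (rcons p y) -> e x y -> p = [::].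
Proof.
move=> ac up pS xp xy; case: p up pS xp => // z p up pS xp; case: ac.
exists (x :: rcons (z :: p) y); split=> //; first by rewrite /= size_rcons.
  exact/allP.
by rewrite /cycle rcons_path xp last_rcons es.
Qed.

(** Shorten the walk to a path and split it at an inner vertex in [T]. If there is none, the path is
    a single edge, as otherwise a path in [T] would close it to a cycle. *)
Lemma forest_capI (S T : {set X}) x p : ~ has_cycle_in e [set: X] -> connected_in e T ->
  {subset x :: p <= S} -> path e x p -> x \in T -> last x p \in T ->
  connect (restr e (S :&: T)) x (last x p).
Proof.
move=> ac cT; have [m] := ubnP (size p); elim: m x p => // m IH x p; rewrite ltnS => pm pS xp xT lT.
case/shortenP: xp lT => q xq uq qp lT.
have qm : size q <= m.
  by apply: leq_trans pm; apply: uniq_leq_size => //; case/andP: uq.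
have {qp} qS : {subset x :: q <= S}.
  move=> z; rewrite inE => /orP[/eqP->|/qp zp]; first by apply: pS; rewrite mem_head.
  by apply: pS; rewrite inE zp orbT.
case: (lastP q) xq uq lT qm qS => [|{q pm pS}p y]; first by move=> *; apply: connect0.
rewrite last_rcons size_rcons => xp up yT pm pS.
have [/hasP[z zp zT]|nT] := boolP (has (mem T) p).
  case/splitPr: zp xp up pm pS => p1 p2; rewrite -cats1 -catA cat_path /= => /and3P[p1P lz p2P].
  rewrite size_cat /= => _ pm pS.
  have m1 : size (rcons p1 z) < m.
    by rewrite size_rcons; apply: leq_ltn_trans pm; rewrite addnS ltnS leq_addr.
  have m2 : size (rcons p2 y) < m.
    by rewrite size_rcons; apply: leq_ltn_trans pm; rewrite leq_addl.
  have c1 := IH x (rcons p1 z) m1; rewrite last_rcons rcons_path p1P lz in c1.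
  have c2 := IH z (rcons p2 y) m2; rewrite last_rcons -cats1 p2P in c2.
  apply: connect_trans (c1 _ isT xT zT) (c2 _ isT zT yT) => w H; apply: pS; move: H.
    by rewrite !(inE, mem_rcons, mem_cat); case/or3P=> ->; rewrite ?orbT.
  by rewrite !(inE, mem_cat) => /or3P[] ->; rewrite ?orbT.
have xS : x \in S by apply: pS; rewrite mem_head.
have yS : y \in S by apply: pS; rewrite inE mem_rcons mem_head orbT.
case: p xp up pm nT pS => [|z p] xp up pm nT pS.
  by apply: connect1; move: xp; rewrite /= andbT /restr !inE xS xT yS yT => ->.
have /connectP[q0 q0P El] := cT y x yT xT.
have [yq q0T] := path_restr q0P.
case/shortenP: yq El => q yq uq qq0 El; case: ac.
have xy : x != y by apply: contraTneq up => ->; rewrite /= inE mem_rcons mem_head orbT.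
case: (lastP q) yq uq qq0 El => [|{}q w]; first by move=> _ _ _ E; rewrite E eqxx in xy.
rewrite last_rcons => yq uq qq0 E; subst w.
have qT w : w \in q -> w \in T by move=> wq; apply/q0T/qq0; rewrite mem_rcons inE wq orbT.
exists (x :: z :: p ++ y :: q); split=> //.
- have /= /and3P[xn zn up'] := up; have /= /andP[yn uq'] := uq.
  move: xn zn up' yn uq'; rewrite !inE !mem_rcons !inE !rcons_uniq !negb_or.
  move=> /and3P[xz _ xp'] /andP[zy zp] /andP[yp up'] /andP[_ yq'] /andP[xq uq'].
  have nq w : w \in z :: p -> w \notin q.
    by move=> wp; apply/negP=> /qT wT; case/hasP: nT; exists w.
  rewrite /= !(inE, mem_cat) !negb_or xz xp' xy xq zp zy (nq z) ?mem_head //=.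
  rewrite cat_uniq up' /= yq' uq' negb_or yp /= andbT -all_predC.
  by apply/allP=> w wq /=; apply: contraL wq => wp; apply: nq; rewrite inE wp orbT.
- by rewrite /= size_cat /=; lia.
- by apply/allP=> w _; rewrite inE.
- move: xp; rewrite /cycle /= => /andP[xz]; rewrite rcons_path => /andP[zp py].
  by rewrite xz rcons_cat cat_path zp /= py yq.
Qed.

Lemma forest_cap (S T : {set X}) : ~ has_cycle_in e [set: X] ->
  connected_in e S -> connected_in e T -> connected_in e (S :&: T).
Proof.
move=> ac cS cT x y /setIP[xS xT] /setIP[yS yT].
have /connectP[p pP E] := cS x y xS yS; have [xp pS] := path_restr pP.
rewrite E; apply: forest_capI => //; last by rewrite -E.
by move=> z; rewrite inE => /orP[/eqP->|/pS].
Qed.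

(** Otherwise [S :&: (T :|: U)], being connected, has an edge from [u] in [T] to [v] in [U] outside
    [T]. As [(T :|: [set v]) :&: U] is connected, [v] has a neighbour [z] in [T :&: U]. The
    intersection of [[set u; v; z]] with [T] is [[set u; z]]; it is connected, which gives a
    triangle. *)
Lemma forest_helly (S T U : {set X}) a b c : irreflexive e -> ~ has_cycle_in e [set: X] ->
  connected_in e S -> connected_in e T -> connected_in e U ->
  a \in S -> a \in T -> b \in T -> b \in U -> c \in U -> c \in S ->
  exists x, [/\ x \in S, x \in T & x \in U].
Proof.
move=> ei ac cS cT cU aS aT bT bU cU' cS'.
case: (pickP [pred x | [&& x \in S, x \in T & x \in U]]) => [x /and3P[*]|no]; first by exists x.
have cW := forest_cap ac cS (connectedU es cT cU bT bU).
have cT' : c \notin T by apply/negP=> cT'; have := no c; rewrite /= cS' cT' cU'.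
have [||u [v [uW vW uv uT vT]]] := connected_cross (x := a) (y := c) (P := T) cW _ _ aT cT'.
- by rewrite !inE aS aT.
- by rewrite !inE cS' cU' orbT.
move: uW vW; rewrite !inE (negbTE vT) /= => /andP[uS _] /andP[vS vU].
have uU : u \notin U by apply/negP=> uU; have := no u; rewrite /= uS uT uU.
have cTv : connected_in e (T :|: [set v]).
  by apply: (connectedU_edge (x := u) (y := v)) => //; [exact: connected1 | exact: set11].
have [||z [w [zW wW zw zT wT]]] :=
    connected_cross (x := b) (y := v) (P := T) (forest_cap ac cTv cU) _ _ bT vT.
- by rewrite !inE bT bU.
- by rewrite !inE eqxx orbT.
move: zW wW; rewrite !inE zT (negbTE wT) /= => zU /andP[/eqP E _]; subst w.
have cuvz : connected_in e ([set u; v] :|: [set z]).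
  have vz : e v z by rewrite es.
  exact: (connectedU_edge es (connected2 es uv) (connected1 e (x := z)) (set22 u v) (set11 z) vz).
have zu : z != u by apply: contraNneq uU => <-.
have [|||u' [z' [uW zW uz uu zz]]] :=
    connected_cross (x := u) (y := z) (P := [set u]) (forest_cap ac cuvz cT) _ _ (set11 u) _.
- by rewrite !inE eqxx uT.
- by rewrite !inE eqxx orbT.
- by rewrite inE.
move: uu zz uW zW; rewrite !inE => /eqP E1 zz' _ /andP[]; subst u'; rewrite (negbTE zz') /=.
case/orP=> /eqP E; subst z'; first by rewrite (negbTE vT).
move=> _; case: ac; exists [:: u; v; z]; split=> //=.
- rewrite !inE !negb_or [u == z]eq_sym zu !andbT; apply/andP; split.
    by apply: contraNneq vT => <-.
  by apply: contraNneq vT => ->.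
- by rewrite !inE.
- by rewrite uv es zw es uz.
Qed.

End Acyclic.

Lemma tree_decomp_bags (V X : finType) (e : rel V) (eX : rel X) (A S : {set V}) B :
  symmetric eX -> tree_decomp e A eX B -> S \subset A -> connected_in e S ->
  connected_in eX (\bigcup_(v in S) [set x | v \in B x]).
Proof.
move=> es [_ Be _ Bc] /subsetP SA cS; apply: connected_bigcup es cS _ _.
  by move=> v /SA; apply: Bc.
move=> u v /SA uA /SA vA /(Be u v uA vA)[x]; by exists x; rewrite !inE.
Qed.

(** Every vertex shares a bag with [v0], so by the Helly property two vertices sharing a bag share
    one that contains [v0]. Each of the at most [p.+1] nodes in a bag [W i] is replaced by its at
    most [w.+1] vertices. *)
Lemma good_td_dominated (G : sgraph) w p (v0 : gV G) : has_good_td G w p ->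
  (forall u, u != v0 -> gadj G v0 u) -> pathwidth_le (gadj G) setT (p.+1 * w.+1).
Proof.
case=> X [eX [B [[es ei _ _ ac] [_ Be Bv Bc] Bw Bp]]] dom.
have [X' [eX' [W [pX [WS We Wv Wc] Ww]]]] := Bp v0.
have es' : symmetric eX' by case: pX => -[].
have m0 u : exists x, (u \in B x) && (v0 \in B x).
  have [->|uv] := eqVneq u v0.
    by have [x xB] := Bv v0 (in_setT _); exists x; rewrite xB.
  by apply: Be; rewrite ?inE // gsym dom.
have m2 u v : (exists x, (u \in B x) && (v \in B x)) ->
    exists x, [/\ u \in B x, v \in B x & v0 \in B x].
  case=> x /andP[ux vx]; have [y /andP[vy v0y]] := m0 v; have [z /andP[uz v0z]] := m0 u.
  have [||||||y' []] := @forest_helly X eX es [set x | u \in B x] [set x | v \in B x]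
    [set x | v0 \in B x] x y z ei ac (Bc u (in_setT _)) (Bc v (in_setT _)) (Bc v0 (in_setT _));
    rewrite ?inE //.
  by exists y'.
have m3 u v : (exists x, (u \in B x) && (v \in B x)) ->
    exists i, (u \in \bigcup_(x in W i) B x) && (v \in \bigcup_(x in W i) B x).
  move=> /m2[x [ux vx v0x]]; have [i xi] : exists i, x \in W i by apply: Wv; rewrite inE.
  by exists i; apply/andP; split; apply/bigcupP; exists x.
exists X', eX', (fun i => \bigcup_(x in W i) B x); split=> //; last first.
  by move=> i; apply: leqW; apply: leq_trans (card_bigcup_le _ Bw) _; rewrite leq_mul2r Ww orbT.
split=> [i|u v _ _ uv|u _|u _].
- exact: subsetT.
- by apply/m3/Be; rewrite ?inE.
- have [x xB] := Bv u (in_setT _); have [i /andP[ui _]] := m3 u u (ex_intro _ x (introT andP (conj xB xB))).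
  by exists i.
have -> : [set i | u \in \bigcup_(x in W i) B x] =
    \bigcup_(x in [set x | u \in B x] :&: [set x | v0 \in B x]) [set i | x \in W i].
  apply/setP=> i; rewrite inE; apply/bigcupP/bigcupP => -[x].
    by move=> xi ux; exists x; rewrite ?inE ?ux //; have := subsetP (WS i) x xi; rewrite inE.
  by rewrite !inE => /andP[ux _] xi; exists x.
apply: (connected_bigcup (e := eX) es').
- exact: forest_cap ac (Bc u (in_setT _)) (Bc v0 (in_setT _)).
- by move=> x; rewrite !inE => /andP[_ vx]; apply: Wc; rewrite inE.
- move=> x y; rewrite !inE => /andP[_ vx] /andP[_ vy] xy.
  by have [||//|i] := We x y; rewrite ?inE //; exists i; rewrite !inE.
Qed.

(** * Apex-forests of large pathwidth; minors from tree models *)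

(* The bags meeting a connected subgraph form a subpath: a path graph is a sequence,
   namely one of its longest paths. *)
Lemma path_graph_order (X : finType) (e : rel X) : is_path_graph e ->
  exists pos : X -> nat, forall S, connected_in e S ->
    forall x y z, x \in S -> z \in S -> pos x <= pos y <= pos z -> y \in S.
Proof.
case=> -[es ei X0 cT ac] deg.
have [|x0 [s [uq _ sq mq]]] := @longest_path _ e setT; first by rewrite -card_gt0 cardsT.
pose q := x0 :: s.
have mq' t : uniq t -> sorted e t -> size t <= size q.
  by case: t => // y t ut pt; rewrite ltnS; apply: (mq y) => // w _; rewrite inE.
(* A missing vertex adjacent to the path would prolong it at an end or give an inner vertex degree
   three. *)
have allq x : x \in q.
  suff : [set: X] \subset [set y in q] by move/subsetP/(_ x (in_setT _)); rewrite inE.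
  apply: (connected_closed (x := x0) cT); rewrite ?inE ?eqxx // => u v _ _ uv.
  rewrite [u \in _]inE [v \in _]inE => uin; apply/negPn/negP=> vq.
  have sq' : sorted e q := sq.
  move: uin mq' uq sq' vq; rewrite -/q; move: q => {mq sq s}q uin.
  case/splitPr: uin => p1 p2; case: (lastP p1) => [|{}p1 a] mq' uq sq vq.
    have := mq' [:: v, u & p2]; rewrite cons_uniq vq uq /= es uv /= => /(_ isT sq).
    by rewrite ltnn.
  case: p2 mq' uq sq vq => [|b p2] mq' uq sq vq.
    have := mq' (rcons (rcons p1 a ++ [:: u]) v); rewrite rcons_uniq vq uq => /(_ isT).
    rewrite size_rcons ltnn => H; apply: notF; apply: H; move: sq.
    case: (rcons p1 a ++ [:: u]) (last_cat x0 (rcons p1 a) [:: u]) => [//|c r] /= El cr.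
    by rewrite rcons_path cr El.
  move: sq; rewrite cat_rcons => /cat_sorted2[_ /= /and3P[au ub _]].
  have := deg u; rewrite leqNgt; apply/negP; rewrite negbK.
  have sub : v |: [set a; b] \subset [set y | e u y].
    by apply/subsetP=> y; rewrite !inE => /or3P[] /eqP->; rewrite // es.
  apply: leq_trans (subset_leq_card sub); rewrite cardsU1 cards2 !inE.
  move: vq uq; rewrite mem_cat mem_rcons !inE !negb_or => /andP[/andP[va _] /and3P[_ vb _]].
  rewrite va vb cat_uniq => /and3P[_ H _].
  suff -> : a != b by [].
  apply: contraNneq H => ->; apply/hasP; exists b; by rewrite ?inE ?mem_rcons ?inE eqxx ?orbT.
(* A longer stretch of the path between adjacent vertices would close a cycle. *)
have succ u v : e u v -> index u q < index v q -> index v q = (index u q).+1.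
  have sq' : sorted e q := sq.
  move=> uv; move: (allq u) (allq v) uq sq'; clear mq' allq; rewrite -/q; move: q => {mq sq s}q uin.
  case/splitPr: uin => p1 p2; rewrite mem_cat inE cat_uniq => vin /and3P[_ h1 u2] sq.
  have up1 : u \notin p1 by apply: contra h1 => up1; apply/hasP; exists u; rewrite ?inE ?eqxx.
  rewrite !index_cat (negbTE up1) /= eqxx addn0.
  case/or3P: vin => [vp1|/eqP vu|vp2].
  - by rewrite vp1 => /ltnW; rewrite leqNgt index_mem vp1.
  - by rewrite vu ei in uv.
  have vp1 : v \notin p1 by apply: contra h1 => vp1; apply/hasP; exists v; rewrite // inE vp2 orbT.
  have vu : u != v by apply: contraTneq uv => ->; rewrite ei.
  rewrite (negbTE vp1) (negbTE vu) => _.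
  case/splitPr: vp2 u2 sq {h1} => p3 p4 u2 /cat_sorted2[_ /=].
  rewrite -cat_rcons cat_path => /andP[pt _].
  have -> : p3 = [::].
    apply: (acyclic_chord es ac _ _ pt uv).
      by move: u2; rewrite -cat_rcons -cat_cons cat_uniq => /andP[].
    by move=> w _; rewrite inE.
  by rewrite /= eqxx addn1.
exists (index^~ q) => S cS x y z xS zS /andP[xy yz].
apply/negPn/negP => yS.
have ne w : w \in S -> index w q != index y q.
  move=> wS; apply: contraNneq yS => E.
  by rewrite -(nth_index x0 (allq y)) -E nth_index.
(* If [S] misses [y], some edge in [S] jumps over [y], although edges join consecutive positions. *)
have [||u [v [uS vS uv]]] := @connected_cross _ e S [set w | index w q < index y q] x z cS xS zS.
- by rewrite inE ltn_neqAle ne.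
- by rewrite inE -leqNgt.
rewrite !inE -leqNgt => uy yv.
have := succ u v uv (leq_trans uy yv); have := ne v vS; lia.
Qed.

(** Complete ternary tree of height [h]: [None] is the root and [Some (i, y)] is the node [y] of
    branch [i]. *)
Fixpoint tern h : finType := if h is h'.+1 then option ('I_3 * tern h') else unit.

Fixpoint tern_root h : tern h :=
  match h with 0 => tt | _.+1 => None end.

Fixpoint tern_par h : tern h -> tern h :=
  match h with
  | 0 => fun x => x
  | h'.+1 => fun x =>
    if x is Some (i, y) then
      if y == tern_root h' then None else Some (i, tern_par y)
    else None
  end.

Fixpoint tern_rk h : tern h -> nat :=
  match h with
  | 0 => fun=> 0
  | h'.+1 => fun x => if x is Some (_, y) then (tern_rk y).+1 else 0
  end.

Lemma tern_rkP h (x : tern h) : tern_par x != x -> tern_rk (tern_par x) < tern_rk x.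
Proof.
elim: h x => [[]|h IH [[i y]|]] //=.
case: (y =P tern_root h) => // yr H; rewrite ltnS; apply: IH.
by apply: contraNneq H => ->.
Qed.

Lemma tern_par_neq h (x : tern h) : x != tern_root h -> tern_par x != x.
Proof.
elim: h x => [[]|h IH [[i y]|]] //= _; case: (y =P tern_root h) => // /eqP yr.
by apply: contra (IH y yr) => /eqP[->].
Qed.

Definition tern_adj h : rel (tern h) := ptree (@tern_par h).

Lemma tern_adjS h i (x y : tern h) :
  tern_adj x y -> tern_adj (Some (i, x) : tern h.+1) (Some (i, y)).
Proof.
rewrite /tern_adj /ptree => /andP[xy par_xy].
have -> /= : Some (i, x) != Some (i, y) by apply: contraNneq xy => -[->].
have rt : tern_par (tern_root h) = tern_root h by case: (h).
case/orP: par_xy => /eqP E.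
  have xr : x != tern_root h by apply: contraNneq xy => xr; rewrite -E xr rt.
  by rewrite (negbTE xr) E eqxx.
have yr : y != tern_root h by apply: contraNneq xy => yr; rewrite -E yr rt.
by rewrite (negbTE yr) E eqxx orbT.
Qed.

(* Among the bags rich in vertices of three branches, the middle one also meets the connected
   union of the root with the two other branches. *)
Lemma tern_pathwidth (V X : finType) (e : rel V) (eX : rel X) (B : X -> {set V}) :
  is_path_graph eX -> tree_decomp e setT eX B ->
  forall h (f : tern h -> V), injective f -> {homo f : x y / tern_adj x y >-> e x y} ->
  exists x, h < #|B x :&: f @: setT|.
Proof.
move=> pX td; have esX : symmetric eX by case: pX => -[].
have [pos posP] := path_graph_order pX.
elim=> [|h IH] f fi fh.
  have [_ _ /(_ (f tt) (in_setT _))[x xf] _] := td.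
  by exists x; apply/card_gt0P; exists (f tt); rewrite inE xf imset_f.
have g i := IH (fun y => f (Some (i, y)))
  (fun y z E => f_equal (fun u => if u is Some (_, w) then w else y) (fi _ _ E))
  (fun y z yz => fh _ _ (tern_adjS i yz)).
have [x Hx] : exists x : 'I_3 -> X, forall i, h < #|B (x i) :&: (fun y => f (Some (i, y))) @: setT|.
  exact: fin_all_exists g.
have [a [b [c [ab bc pab pbc]]]] : exists a b c : 'I_3,
    [/\ a != b, c != b, pos (x a) <= pos (x b) & pos (x b) <= pos (x c)].
  pose i0 := @Ordinal 3 0 isT; pose i1 := @Ordinal 3 1 isT; pose i2 := @Ordinal 3 2 isT.
  case: (leqP (pos (x i0)) (pos (x i1))) => h01; case: (leqP (pos (x i1)) (pos (x i2))) => h12;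
    case: (leqP (pos (x i0)) (pos (x i2))) => h02.
  - by exists i0, i1, i2.
  - by exists i0, i1, i2.
  - by exists i0, i2, i1; split=> //; apply: ltnW.
  - by exists i2, i0, i1; split=> //; apply: ltnW.
  - by exists i1, i0, i2; split=> //; apply: ltnW.
  - by exists i1, i2, i0; split=> //; apply: ltnW.
  - by exists i2, i1, i0; split=> //; apply: ltnW.
  - by exists i2, i1, i0; split=> //; apply: ltnW.
pose T : {set tern h.+1} := [set z | if z is Some (i, _) then i != b else true].
have cT : connected_in (@tern_adj h.+1) T.
  apply: (@ptree_connected _ _ _ (@tern_rkP h.+1) _ None) => -[[i y]|//]; rewrite inE => ib _ /=.
  split; last exact: (@tern_par_neq h.+1 (Some (i, y))).
  by case: (y =P tern_root h) => _; rewrite inE.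
have cfT : connected_in e (f @: T) by apply: connected_image cT => u v _ _; apply: fh.
have cU := tree_decomp_bags esX td (subsetT _) cfT.
have inU i : i != b -> x i \in \bigcup_(v in f @: T) [set z | v \in B z].
  move=> ib; have /card_gt0P[v] : 0 < #|B (x i) :&: (fun y => f (Some (i, y))) @: setT|.
    exact: leq_ltn_trans (Hx i).
  case/setIP=> vB /imsetP[y _ E]; apply/bigcupP; exists v; last by rewrite inE.
  by rewrite E; apply: imset_f; rewrite inE.
have /bigcupP[v vT] : x b \in \bigcup_(v in f @: T) [set z | v \in B z].
  by apply: (posP _ cU (x a) (x b) (x c)); rewrite ?inU ?pab.
rewrite inE => vB; exists (x b).
pose Sb := B (x b) :&: (fun y => f (Some (b, y))) @: setT.
have vS : v \notin Sb.
  apply/negP=> /setIP[_ /imsetP[y _ E]]; case/imsetP: vT => z zT.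
  by rewrite E => /fi zE; move: zT; rewrite -zE inE eqxx.
apply: (@leq_trans #|v |: Sb|); first by rewrite cardsU1 vS; apply: Hx.
apply/subset_leq_card/subsetP=> w /setU1P[->|/setIP[wB /imsetP[y _ E]]].
  by rewrite inE vB; case/imsetP: vT => z _ ->; apply: imset_f.
by rewrite inE wB E imset_f.
Qed.

Section ApexTern.
Variable h : nat.

Definition apex_adj : rel (option (tern h)) := fun x y =>
  match x, y with
  | None, None => false
  | Some u, Some v => tern_adj u v
  | _, _ => true
  end.

Lemma apex_sym : symmetric apex_adj.
Proof. by move=> [x|] [y|] //=; apply: ptree_sym. Qed.

Lemma apex_irr : irreflexive apex_adj.
Proof. by move=> [x|] //=; apply: ptree_irr. Qed.

Definition apex_tern := SGraph apex_sym apex_irr.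

Lemma apex_tern_forest : apex_forest apex_tern.
Proof.
exists None; case=> s [us ss sS cs].
pose par (x : option (tern h)) := omap (@tern_par h) x.
pose rk (x : option (tern h)) := if x is Some y then tern_rk y else 0.
have rkP x : par x != x -> rk (par x) < rk x.
  by case: x => [x|] //= H; apply: tern_rkP; apply: contraNneq H => ->.
apply: (@ptree_acyclic _ par rk rkP [set~ None]); exists s; split=> //.
apply: sub_in_cycle sS cs => -[x|] [y|]; rewrite !inE //= => _ _.
Qed.

Lemma apex_tern_dom (u : gV apex_tern) : u != None -> gadj apex_tern None u.
Proof. by case: u. Qed.

End ApexTern.

(** Height [k.+1] forces a bag with [k.+2] vertices, one too many for width [k]. *)
Lemma apex_tern_pathwidth k : ~ pathwidth_le (gadj (apex_tern k.+1)) setT k.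
Proof.
case=> X [eX [B [pX td Bk]]].
have [|x] := @tern_pathwidth _ _ _ _ _ pX td k.+1 (fun y => Some y) Some_inj; first by [].
apply/negP; rewrite -leqNgt; apply: leq_trans (Bk x).
exact: subset_leq_card (subsetIl _ _).
Qed.

(** An end [x] of a longest path has at most one neighbour in [S], the next vertex on the path. It
    is put after an enumeration of [S :\ x], with that neighbour as parent. *)
Lemma forest_enum (V : finType) (e : rel V) (S : {set V}) : symmetric e -> irreflexive e ->
  ~ has_cycle_in e S -> exists (q : seq V) (par : nat -> nat),
  [/\ uniq q, q =i S, forall j, 0 < j -> par j < j &
      forall x0 i j, i < j < size q -> e (nth x0 q j) (nth x0 q i) -> i = par j].
Proof.
move=> es ei; have [m] := ubnP #|S|; elim: m S => // m IH S; rewrite ltnS => Sm ac.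
have [->|S0] := eqVneq S set0.
  exists [::], (fun=> 0); split=> [//|x|//|x0 i j]; first by rewrite inE.
  by rewrite ltn0 andbF.
have [x [s [us sS ps ms]]] := longest_path e S0.
have xS : x \in S by apply: sS; rewrite mem_head.
have nx y : y \in S -> e x y -> y = head x s.
  move=> yS xy; have yx : y != x by apply: contraTneq xy => ->; rewrite ei.
  have ys : y \in s.
    apply/negPn/negP=> ys; have := ms y (x :: s); rewrite cons_uniq inE negb_or yx ys us /= ps es xy.
    rewrite ltnn => H; apply: notF; apply: H => // z; rewrite inE => /orP[/eqP->//|]; exact: sS.
  case/splitPr: ys us sS ps {ms} => p1 p2 us sS ps.
  rewrite -cat_rcons cat_path in ps; case/andP: ps => ps _.
  rewrite (_ : p1 = [::]) //; apply: (acyclic_chord es ac _ _ ps xy).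
    by move: us; rewrite -cat_rcons -cat_cons cat_uniq => /andP[].
  by move=> w ws; apply: sS; rewrite -cat_rcons -cat_cons mem_cat ws.
have [||q [par [uq qS hp hq]]] := IH (S :\ x).
- by move: Sm; rewrite (cardsD1 x S) xS.
- by case=> c [uc sc /allP cS cc]; case: ac; exists c; split=> //; apply/allP=> z /cS /setD1P[].
(* If [x] is isolated then [head x s] is [x], which is not in [q]; the minimum with [j.-1] still
   keeps the parent below [j]. *)
exists (rcons q x), (fun j => if j == size q then minn (index (head x s) q) j.-1 else par j); split.
- by rewrite rcons_uniq uq qS !inE eqxx.
- by move=> z; rewrite mem_rcons inE qS !inE; case: eqP => [->|].
- by move=> j j0; case: eqP => _; [lia | apply: hp].
move=> x0 i j; rewrite size_rcons ltnS => /andP[ij jq].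
have iq : i < size q by apply: leq_trans jq.
rewrite !nth_rcons iq; case: (ltngtP j (size q)) => [jq'|jq'|E].
- by apply: hq; rewrite ij.
- by move: jq; rewrite leqNgt jq'.
move=> xi; have yS : nth x0 q i \in S :\ x by rewrite -qS mem_nth.
have <- : nth x0 q i = head x s by apply: nx => //; case/setD1P: yS.
by rewrite index_uniq //; lia.
Qed.

Lemma apex_forest_tree_free (H : sgraph) : apex_forest H -> exists par n,
  [/\ forall j, 0 < j -> par j < j, 0 < n &
      forall G : sgraph, ~ minor H G -> apex_tree_free (gadj G) par n].
Proof.
case=> v /(forest_enum (@gsym H) (@girr H))[q [par [uq qS hp hq]]].
(* The extra tree vertex keeps the tree nonempty when [q] is empty, and adjacency to it makes [Y]
   nonempty. *)
exists par, (size q).+1; split=> // G nm Y b cY [cb Db Ab] HY; apply: nm.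
have qi z : z != v -> index z q < size q by move=> zv; rewrite index_mem qS !inE.
have qi' z : z != v -> index z q < (size q).+1 by move=> /qi; apply: ltnW.
pose phi z := if z == v then Y else b (index z q).
have edge z z' : z != v -> z' != v -> index z q < index z' q -> gadj H z z' ->
    exists u w, [&& u \in phi z, w \in phi z' & gadj G u w].
  move=> zv zv' lt zz'.
  have E : index z q = par (index z' q).
    apply: (hq v); first by rewrite lt qi.
    by rewrite !nth_index ?qS ?inE // gsym.
  have [|u [w /and3P[ub wb uw]]] := Ab (index z' q); first by rewrite (leq_ltn_trans _ lt) // qi'.
  by exists w, u; rewrite /phi (negbTE zv) (negbTE zv') E wb ub gsym.
have edgev z : z != v -> exists u w, [&& u \in phi z, w \in phi v & gadj G u w].
  move=> zv; have [_ [x [y /and3P[xb yY xy]]]] := HY _ (qi' z zv).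
  by exists x, y; rewrite /phi (negbTE zv) eqxx xb yY.
exists phi; split.
- move=> z; apply/set0Pn; rewrite /phi; case: (eqVneq z v) => [_|zv].
    by have [_ [x [y /and3P[_ yY _]]]] := HY 0 isT; exists y.
  by have [_ [x [y /and3P[xb _ _]]]] := HY _ (qi' z zv); exists x.
- by move=> z; rewrite /phi; case: (eqVneq z v) => // zv; apply/cb/qi'.
- move=> z z' zz'; rewrite /phi; case: (eqVneq z v) => zv; case: (eqVneq z' v) => zv'.
  + by rewrite zv zv' eqxx in zz'.
  + by rewrite disjoint_sym; have [] := HY _ (qi' z' zv').
  + by have [] := HY _ (qi' z zv).
  apply: Db; rewrite ?qi' //; apply: contraNneq zz' => E.
  by rewrite -(nth_index v (_ : z \in q)) ?qS ?inE // E nth_index ?qS ?inE.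
move=> z z' zz'; case: (eqVneq z v) => [zv|zv].
  have zv' : z' != v by apply: contraTneq zz' => ->; rewrite zv girr.
  by rewrite zv; have [u [w /and3P[? ? ?]]] := edgev z' zv'; exists w, u; apply/and3P; rewrite gsym.
case: (eqVneq z' v) => [->|zv']; first exact: edgev.
case: (ltngtP (index z q) (index z' q)) => E; first exact: edge.
  have [u [w /and3P[? ? ?]]] := edge z' z zv' zv E (etrans (gsym _ _) zz').
  by exists w, u; apply/and3P; rewrite gsym.
have Ez : z = z' by rewrite -(nth_index v (_ : z \in q)) ?qS ?inE // E nth_index ?qS ?inE.
by rewrite Ez girr in zz'.
Qed.

(** * Good tree decompositions *)

(** The parent function, with a rank that decreases along it, allows trees to be glued by
    redirecting roots; [ptree] recovers the graph. *)
Record rtd (V : finType) := Rtd {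
  node : finType; rroot : node; rpar : node -> node; rrk : node -> nat;
  bag : node -> {set V} }.
Arguments rroot {V}.

Section RootedDecomp.
Variables (V : finType) (e : rel V).
Implicit Types (D : {set V}) (d : rtd V).

(* The nodes whose bags contain [v] have an interval path decomposition with bags of size [w]. *)
Definition narrow d v w := exists (s t : node d -> nat) m,
  [/\ forall x, v \in bag x -> s x <= t x < m,
      forall x, rpar x != x -> v \in bag x -> v \in bag (rpar x) ->
        s x <= t (rpar x) /\ s (rpar x) <= t x &
      forall i, #|[set x | (v \in bag x) && (s x <= i <= t x)]| <= w].

Definition rooted_tree d :=
  [/\ forall x : node d, rpar x != x -> rrk (rpar x) < rrk x,
      rpar (rroot d) = rroot d & forall x : node d, x != rroot d -> rpar x != x].

(** Such a tree is to be hung below a node whose bag contains [nb e D]. The nodes of a vertex are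
    connected because they climb to a topmost one, the root for vertices of [nb e D]. These get the
    stricter bound 2 because they belong to an enclosing core, whose path uses another 2. *)
Definition good_rtd D d q :=
  [/\ rooted_tree d,
      forall x : node d, bag x \subset D :|: nb e D /\ #|bag x| <= 2 * q,
      nb e D \subset bag (rroot d),
      forall u v, u \in D -> v \in D :|: nb e D -> e u v ->
        exists x : node d, (u \in bag x) && (v \in bag x) &
      [/\ forall v, v \in D -> exists x : node d, v \in bag x,
          forall v, v \in nb e D -> forall x : node d,
            x != rroot d -> v \in bag x -> v \in bag (rpar x),
          forall v, v \in D -> exists top : node d, forall x : node d,
            x != top -> v \in bag x -> x != rroot d /\ v \in bag (rpar x),
          forall v, v \in nb e D -> narrow d v 2 &
          forall v, v \in D -> narrow d v 4]].

End RootedDecomp.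

Lemma has_good_td_rtd (G : sgraph) (d : rtd (gV G)) q :
  rooted_tree d -> (forall x : node d, #|bag x| <= 2 * q) ->
  (forall u v, gadj G u v -> exists x : node d, (u \in bag x) && (v \in bag x)) ->
  (forall v, [/\ exists x : node d, v \in bag x,
      exists top : node d, forall x : node d,
        x != top -> v \in bag x -> x != rroot d /\ v \in bag (rpar x) & narrow d v 4]) ->
  has_good_td G (2 * q) 3.
Proof.
move=> [rkP rE rneq] bq be bv; exists (node d), (ptree (@rpar _ d)), (@bag _ d); split.
- exact: (ptree_tree rkP rneq).
- split=> [x|u v _ _|v _|v _].
  + exact: subsetT.
  + exact: be.
  + by have [] := bv v.
  + have [_ [top topP] _] := bv v; apply: (ptree_connected rkP (t := top)) => x.
    rewrite !inE => vx xt; have [xr vp] := topP x xt vx; split=> //; exact: rneq.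
- by move=> x; apply: leqW.
move=> v; have [_ _ [s [t [m [st adj cnt]]]]] := bv v.
exists _, (ptree (@pathpar m)),
  (fun i : 'I_m.+1 => [set x in [set x : node d | v \in bag x] | s x <= i <= t x]); split.
- exact: ptree_path.
- apply: interval_decomp => [x|x y]; rewrite inE.
    by move=> /st/andP[sx tm]; split=> //; apply: ltnW; apply: leq_ltn_trans tm.
  rewrite inE => vx vy; rewrite /ptree => /andP[xy /orP[/eqP E|/eqP E]]; subst.
    by apply: adj; rewrite // eq_sym.
  by have [] := adj y xy vy vx.
move=> i; apply: leq_trans (cnt i); apply/subset_leq_card/subsetP=> x.
by rewrite !inE.
Qed.


(** * Hanging the trees of the components on the path of a core *)

Section Glue.
Variables (V : finType) (e : rel V) (D A : {set V}) (s t : V -> nat) (q : nat).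
Hypothesis es : symmetric e.
Hypothesis HA : core_decomp e D A s t q.
Hypothesis bA : bd e set0 D \subset A.
Hypothesis nbq : #|nb e D| <= q.
Local Notation I := {K : {set V} | K \in comps e D A}.
Variable d : I -> rtd V.
Hypothesis dP : forall K : I, good_rtd e (val K) (d K) q.

Let tm := \max_v t v.
(** As [s] is constant on a component, the maximum is its common value. *)
Let pos (K : I) := \max_(v in val K) s v.

Definition gnode : finType := ('I_tm.+1 + {K : I & node (d K)})%type.

Definition gpar (x : gnode) : gnode :=
  match x with
  | inl j => inl (pathpar j)
  | inr (existT K z) =>
      if z == rroot (d K) then inl (inord (pos K)) else inr (existT _ K (rpar z))
  end.

Definition grk (x : gnode) : nat :=
  match x with inl j => j | inr (existT K z) => tm.+1 + rrk z end.

Definition gbag (x : gnode) : {set V} :=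
  match x with
  | inl j => [set v in A | s v <= j <= t v] :|: nb e D
  | inr (existT K z) => bag z
  end.

Definition glue := Rtd (inl ord0) gpar grk gbag.

Lemma st_tm v : v \in D -> s v <= t v <= tm.
Proof. by have [_ H _ _ _] := HA => vD; rewrite H // (leq_bigmax v). Qed.

Lemma compsK (K : I) v : v \in val K -> [/\ v \in D, v \notin A & pos K = s v].
Proof.
move=> vK; have := subsetP (comps_sub (valP K)) v vK; rewrite inE => /andP[vA vD].
split=> //; apply/eqP; rewrite eqn_leq; apply/andP; split.
  by apply/bigmax_leqP=> u uK; rewrite (comps_const es HA (valP K) uK vK).
exact: (@leq_bigmax_cond _ (fun v => v \in val K) s v vK).
Qed.

(** An edge between [v] and [K] forces the interval of [v] to contain the single position of [K], so
    the main bag there contains [nb e (val K)]. *)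
Lemma nb_pos (K : I) v : v \in nb e (val K) -> [/\ v \in D, v \in A & s v <= pos K <= t v].
Proof.
move=> vn; have vA := subsetP (comps_nb es bA (valP K)) v vn.
have [AD _ sE tE _] := HA; have vD := subsetP AD v vA; split=> //.
have [_ [u uK uv]] := nbP _ _ _ vn; have [uD uA ->] := compsK uK.
by rewrite -{1}(tE u uD uA) !sE // es.
Qed.

Lemma pos_tm (K : I) : pos K <= tm.
Proof.
apply/bigmax_leqP=> v vK; have [vD _ _] := compsK vK.
by have /andP[h1 h2] := st_tm vD; apply: leq_trans h1 h2.
Qed.

Lemma nb_posq (K : I) : #|nb e (val K)| <= q.
Proof.
have [_ _ _ _ cnt] := HA; apply: leq_trans (cnt (pos K)); apply/subset_leq_card/subsetP=> v.
by move=> /nb_pos[_ vA vp]; rewrite inE vA.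
Qed.

Lemma glue_tree : rooted_tree glue.
Proof.
split.
- move=> [j|[K z]] /=.
    move=> H; have : pathpar j != j by apply: contraNneq H => ->.
    exact: pathpar_lt.
  case: (z =P rroot (d K)) => [_ _|/eqP zr H].
    rewrite /= inordK ltnS ?pos_tm //.
    exact: leq_trans (pos_tm K) (leq_addr _ _).
  rewrite /= ltn_add2l; have [[rkP _ _] _ _ _ _] := dP K; apply: rkP.
  by apply: contraNneq H => ->.
- by rewrite /=; congr inl; apply: val_inj; rewrite /= val_pathpar.
move=> [j|[K z]] /= H.
  have j0 : 0 < j by rewrite lt0n; apply: contraNneq H => j0; apply/eqP; congr inl; apply: val_inj.
  by apply/eqP=> -[E]; have := pathpar_neq j; rewrite j0 E eqxx.
case: (z =P rroot (d K)) => // /eqP zr; have [[_ _ rneq] _ _ _ _] := dP K.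
by apply: contra (rneq z zr) => /eqP; case=> E; apply/eqP; exact: (eq_from_Tagged E).
Qed.

Lemma nb_notin v : v \in nb e D -> v \notin D.
Proof. by case/nbP. Qed.

Lemma main_bag v (j : 'I_tm.+1) : v \in D ->
  (v \in gbag (inl j)) = (v \in A) && (s v <= j <= t v).
Proof. by move=> vD; rewrite /= inE inE orbC (contraTF (@nb_notin v) vD). Qed.

Lemma kid_bag v (K : I) (z : node (d K)) : v \in bag z -> v \in val K :|: nb e (val K).
Proof. by have [_ sub _ _ _] := dP K; have [H _] := sub z; apply: subsetP. Qed.

Lemma kid_bagD v (K : I) (z : node (d K)) : v \in bag z -> v \in D.
Proof. by case/kid_bag/setUP => [/compsK[]|/nb_pos[]]. Qed.

Lemma kid_core v (K : I) (z : node (d K)) : v \in A -> v \in bag z -> v \in nb e (val K).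
Proof. by move=> vA /kid_bag/setUP[/compsK[_]|//]; rewrite vA. Qed.

Lemma kid_hang v (K : I) (z : node (d K)) : v \notin A -> v \in bag z -> v \in val K.
Proof. by move=> vA /kid_bag/setUP[//|/nb_pos[_]]; rewrite (negbTE vA). Qed.

Lemma hang_comp v : v \in D -> v \notin A -> exists K : I, v \in val K.
Proof.
move=> vD vA; have vDA : v \in D :\: A by rewrite inE vA.
by exists (exist (fun K => K \in comps e D A) _ (comp_comps e vDA)); apply: mem_comp.
Qed.

Lemma kid_inj v (K K' : I) : v \in val K -> v \in val K' -> K = K'.
Proof.
move=> vK vK'; apply: val_inj.
by rewrite (comps_comp es (valP K) vK) (comps_comp es (valP K') vK').
Qed.

Lemma main_node v : v \in A -> exists j : 'I_tm.+1, j = s v :> nat /\ v \in gbag (inl j).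
Proof.
have [AD _ _ _ _] := HA => vA; have vD := subsetP AD v vA.
have /andP[st tt'] := st_tm vD.
exists (inord (s v)); rewrite main_bag // vA inordK ?leqnn ?st //.
by rewrite ltnS; apply: leq_trans tt'.
Qed.

Lemma glue_bag (x : node glue) : bag x \subset D :|: nb e D /\ #|bag x| <= 2 * q.
Proof.
have [AD _ _ _ cnt] := HA.
case: x => [j|[K z]] /=; last first.
  have [_ sub _ _ _] := dP K; have [_ H] := sub z; split=> //.
  by apply/subsetP=> v /kid_bagD vD; rewrite inE vD.
split.
  apply: setSU; apply/subsetP=> v; rewrite inE => /andP[vA _]; exact: (subsetP AD).
by rewrite mul2n -addnn; apply: leq_trans (leq_card_setU _ _) _; apply: leq_add.
Qed.

(** Edges leaving [D] start in the core, and every main bag contains [nb e D]. Edges with an end in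
    a component are covered by its tree; for edges inside the core the intervals overlap. *)
Lemma glue_edge u v : u \in D -> v \in D :|: nb e D -> e u v ->
  exists x : node glue, (u \in bag x) && (v \in bag x).
Proof.
move=> uD vD uv; have [AD st sE tE cnt] := HA.
have kid x y : x \in D -> x \notin A -> y \in D -> e x y ->
    exists z : node glue, (x \in bag z) && (y \in bag z).
  move=> xD xA yD xy; have [K xK] := hang_comp xD xA.
  have [_ _ _ ed _] := dP K.
  have [|z xyz] := ed x y xK _ xy; last by exists (inr (existT _ K z)).
  rewrite inE; case: (boolP (y \in val K)) => //= yK; apply/nbP; split=> //; by exists x.
have [vD'|vD'] := boolP (v \in D); last first.
  have vn : v \in nb e D by move: vD; rewrite inE (negbTE vD').
  have uA : u \in A.
    by apply: (subsetP bA); apply/bdP; split=> //; right; exists v.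
  have [j [_ uj]] := main_node uA; exists (inl j).
  by apply/andP; split; rewrite // inE vn orbT.
have [uA|uA] := boolP (u \in A); last exact: kid.
have [vA|vA] := boolP (v \in A); last first.
  by have [|z] := kid v u vD' vA uD; [rewrite es | rewrite andbC; exists z].
have [j [ju uj]] := main_node uA; have [k [kv vk]] := main_node vA.
have suv := sE u v uD vD' uv; have svu : s v <= t u by rewrite sE // es.
case: (leqP (s u) (s v)) => uv'; [exists (inl k) | exists (inl j)].
  by rewrite [u \in _]main_bag // [v \in _]main_bag // uA vA kv uv' svu leqnn st.
by rewrite [u \in _]main_bag // [v \in _]main_bag // uA vA ju suv (ltnW uv') leqnn st.
Qed.

Lemma glue_cover v : v \in D -> exists x : node glue, v \in bag x.
Proof.
move=> vD; have [vA|vA] := boolP (v \in A).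
  by have [j [_ vj]] := main_node vA; exists (inl j).
have [K vK] := hang_comp vD vA; have [_ _ _ _ [cov _ _ _ _]] := dP K.
by have [z vz] := cov v vK; exists (inr (existT _ K z)).
Qed.

Lemma glue_nb_up v : v \in nb e D -> forall x : node glue,
  x != rroot glue -> v \in bag x -> v \in bag (rpar x).
Proof.
move=> vn [j|[K z]] _ /=; first by move=> _; apply/setUP; right.
by move=> /kid_bagD; rewrite (negbTE (nb_notin vn)).
Qed.

Lemma glue_core_up v : v \in A -> forall (K : I) (z : node (d K)), v \in bag z ->
  v \in gbag (gpar (inr (existT _ K z))).
Proof.
move=> vA K z vz; have vn := kid_core vA vz; have [vD _ sp] := nb_pos vn.
rewrite /gpar; case: (z =P rroot (d K)) => [_|/eqP zr].
  by rewrite main_bag // vA inordK // ltnS pos_tm.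
by have [_ _ _ _ [_ up _ _ _]] := dP K; apply: up.
Qed.

Lemma glue_top v : v \in D -> exists top : node glue, forall x : node glue,
  x != top -> v \in bag x -> x != rroot glue /\ v \in bag (rpar x).
Proof.
move=> vD; have [vA|vA] := boolP (v \in A).
  have [j0 [j0v vj0]] := main_node vA; exists (inl j0) => -[j|[K z]] xt vx; last first.
    by split=> //; apply: glue_core_up.
  move: vx; rewrite [v \in _]main_bag // => /and3P[_ sj jt].
  have lt : s v < j.
    rewrite ltn_neqAle sj andbT; apply: contraNneq xt => E; apply/eqP; congr inl.
    by apply: val_inj; rewrite /= j0v.
  split; first by apply/eqP=> -[E]; rewrite E in lt.
  by rewrite [v \in _]main_bag // vA val_pathpar; lia.
have [K vK] := hang_comp vD vA; have [_ _ _ _ [_ _ tops _ _]] := dP K.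
have [top topP] := tops v vK; exists (inr (existT _ K top)) => -[j|[K' z]] xt vx.
  by move: vx; rewrite [v \in _]main_bag // (negbTE vA).
have E := kid_inj vK (kid_hang vA vx); subst K'.
have [|zr vp] := topP z _ vx; first by apply: contraNneq xt => ->.
by split=> //; rewrite /= (negbTE zr).
Qed.

(** Such a [v] is in all main bags and in no child tree. The intervals from [j] to [j.+1] of
    consecutive main nodes meet, and a position lies in at most two of them. *)
Lemma glue_nb_narrow v : v \in nb e D -> narrow glue v 2.
Proof.
move=> vn; pose f (x : gnode) := if x is inl j then nat_of_ord j else 0.
have nk K z : v \in gbag (inr (existT _ K z)) -> False.
  by move=> /kid_bagD; rewrite (negbTE (nb_notin vn)).
exists f, (fun x => (f x).+1), tm.+3; split.
- by move=> [j|[K z]] /= => [_|/nk//]; rewrite leqnSn !ltnS ltnW.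
- move=> [j|[K z]] /= => [H _ _|_ /nk//]; rewrite val_pathpar.
  lia.
move=> i; pose g k : gnode := inl (inord k).
apply: (@leq_trans #|[set g i; g i.-1]|); last by rewrite cards2; case: eqP.
apply/subset_leq_card/subsetP=> -[j|[K z]]; rewrite !inE => /andP[vx /andP[f1 f2]]; last by case: (nk _ _ vx).
move: f1 f2; rewrite /= /g leq_eqVlt => /orP[/eqP <- _|ji ij]; first by rewrite inord_val eqxx.
have -> : i = j.+1 by apply/eqP; rewrite eqn_leq ij.
by rewrite /= inord_val eqxx orbT.
Qed.

(* A node of the main path gets a block of positions, a child tree a subblock of the block of
   the node to which it is attached. *)
Lemma glue_narrow v : v \in D -> narrow glue v 4.
Proof.
(* To the components a core vertex is an outer neighbour, so the child trees use 2 and leave 2 for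
   the main path. A vertex outside the core avoids the main path and may use all 4 in its child
   tree. *)
move=> vD; pose w := if v \in A then 2 else 4.
have nar K : narrow (d K) v w.
  have [_ _ _ _ [_ _ _ nar2 nar4]] := dP K; rewrite /w.
  have nw z : v \in val K :|: nb e (val K) = false -> v \in bag (r := d K) z = false.
    by move=> vN; apply/negP => /kid_bag; rewrite vN.
  have [vKn|/negbTE vKn] := boolP (v \in val K :|: nb e (val K)).
    case/setUP: vKn => [vK|vn]; first by have [_ /negbTE-> _] := compsK vK; apply: nar4.
    by have [_ -> _] := nb_pos vn; apply: nar2.
  exists (fun=> 0), (fun=> 0), 0; split=> [z|z _|i]; try by rewrite nw.
  rewrite (_ : [set _ | _] = set0) ?cards0 //.
  by apply/setP=> z; rewrite !inE nw.
have [S HS] := fin_all_exists nar; have [T HT] := fin_all_exists HS.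
have [m HM] := fin_all_exists HT => {nar HS HT}.
pose M := \max_K m K; pose c (K : I) := nat_of_ord (enum_rank K).
pose W := (#|{: I}| * M).+1.
have MP K : m K <= M by apply: (leq_bigmax K).
have TP K (z : node (d K)) : v \in bag z -> [/\ S K z <= T K z, T K z < M & c K * M + T K z < W].
  move=> vz; have [H _ _] := HM K; have /andP[ST Tm] := H z vz.
  have TM := leq_trans Tm (MP K); split=> //.
  rewrite ltnS; apply: (@leq_trans ((c K).+1 * M)); first by rewrite mulSn addnC leq_add2r ltnW.
  by rewrite leq_mul2r ltn_ord orbT.
(* The interval of a main node also contains the first position of the next block, so that
   consecutive main nodes meet. *)
pose S' (x : gnode) := match x with
  | inl j => j * W | inr (existT K z) => pos K * W + (c K * M + S K z) end.
pose T' (x : gnode) := match x with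
  | inl j => j.+1 * W | inr (existT K z) => pos K * W + (c K * M + T K z) end.
exists S', T', (tm.+2 * W).+1; split.
- move=> [j|[K z]] /= vx.
    by rewrite leq_mul2r leqnSn orbT ltnS leq_mul2r ltnS (leqW (leq_ord j)) orbT.
  have [ST TM TW] := TP K z vx; rewrite !leq_add2l ST ltnS /=.
  apply: (@leq_trans ((pos K).+1 * W)); first by rewrite mulSn addnC leq_add2r ltnW.
  by rewrite leq_mul2r ltnS (leqW (pos_tm K)) orbT.
- move=> [j|[K z]] /= H vx.
    by move=> _; rewrite val_pathpar !leq_mul2r; lia.
  have [ST TM TW] := TP K z vx.
  case: (z =P rroot (d K)) => [_ _|/eqP zr vp] /=.
    rewrite inordK ?ltnS ?pos_tm //; split; last exact: leq_addr.
    rewrite mulSn addnC leq_add2r.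
    by apply: ltnW; apply: leq_ltn_trans TW; rewrite leq_add2l.
  have [_ adj _] := HM K; have [[_ _ rneq] _ _ _ _] := dP K.
  by rewrite !leq_add2l; apply: adj; rewrite // rneq.
move=> i; pose B := [set x : gnode | (v \in gbag x) && (S' x <= i <= T' x)].
rewrite -(cardsID [set x : gnode | if x is inl _ then true else false] B).
have main : #|B :&: [set x : gnode | if x is inl _ then true else false]| <= 4 - w.
  rewrite /w; case: (boolP (v \in A)) => vA.
    pose g k : gnode := inl (inord k).
    apply: (@leq_trans #|[set g (i %/ W); g (i %/ W).-1]|); last by rewrite cards2; case: eqP.
    apply/subset_leq_card/subsetP=> -[j|[K z]]; rewrite !inE ?andbF //= andbT => /and3P[_ ji ij].
    have : j <= i %/ W <= j.+1.
      by rewrite leq_divRL // ji /= -ltnS ltn_divLR // mulSn; lia.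
    rewrite /g => /andP[]; rewrite leq_eqVlt => /orP[/eqP<- _|h1 h2].
      by rewrite inord_val eqxx.
    have -> : i %/ W = j.+1 by apply/eqP; rewrite eqn_leq h2.
    by rewrite /= inord_val eqxx orbT.
  rewrite leqn0 cards_eq0; apply/eqP/setP=> -[j|x]; rewrite !inE ?andbF //=.
  by have := main_bag j vD; rewrite /= !inE (negbTE vA) => ->.
apply: (@leq_trans (4 - w + w)); last by rewrite /w; case: (v \in A).
apply: leq_add main _.
have [->|/set0Pn[x0]] := eqVneq (B :\: [set x : gnode | if x is inl _ then true else false]) set0.
  by rewrite cards0.
have key K z : inr (existT _ K z) \in B -> c K = i %% W %/ M /\ z \in
    [set z : node (d K) | (v \in bag z) && (S K z <= i %% W %% M <= T K z)].
  rewrite !inE => /andP[/= vz xz]; have [_ TM TW] := TP K z vz.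
  by have [-> ->] := block_pos TM TW xz; rewrite vz.
rewrite in_setD => /andP[+ x0B]; case: x0 x0B => [j|[K0 z0]] x0B; rewrite inE // => _.
have [c0 _] := key K0 z0 x0B.
have [_ _ cnt] := HM K0; apply: leq_trans (cnt (i %% W %% M)).
rewrite -(card_imset _ (_ : injective (fun z => inr (existT _ K0 z) : gnode))); last first.
  by move=> z z' [E]; exact: (eq_from_Tagged E).
apply/subset_leq_card/subsetP=> -[j|[K z]]; first by rewrite !inE.
rewrite inE => /andP[_ /key[cK zP]].
have E : K = K0 by apply/enum_rank_inj/val_inj; rewrite /= -/(c _) -/(c _) cK c0.
by subst K; apply: imset_f.
Qed.

Lemma glue_good : good_rtd e D glue q.
Proof.
split; [exact: glue_tree | exact: glue_bag | exact: subsetUr | exact: glue_edge |].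
split; [exact: glue_cover | exact: glue_nb_up | exact: glue_top | exact: glue_nb_narrow |].
exact: glue_narrow.
Qed.

End Glue.

(** The bound on [nb e D] is inherited by each component, whose neighbours lie in the core part of
    one main bag. *)
Lemma rtd_exists (V : finType) (e : rel V) par n : symmetric e ->
  (forall j, 0 < j -> par j < j) -> 0 < n -> apex_tree_free e par n ->
  forall D, apexed e D -> #|nb e D| <= 3 * n -> exists d, good_rtd e D d (3 * n).
Proof.
move=> es hp n0 free D; have [m] := ubnP #|D|; elim: m D => // m IH D; rewrite ltnS => Dm apD nbq.
have [->|D0] := eqVneq D set0.
  have nb0 : nb e set0 = set0.
    by apply/setP=> u; rewrite in_set0; apply/negbTE/nbP => -[_ [v]]; rewrite inE.
  exists (@Rtd V unit tt id (fun=> 0) (fun=> set0)); split.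
  - by split=> [[]|//|[]] //=; rewrite eqxx.
  - by move=> x; rewrite sub0set cards0.
  - by rewrite nb0 sub0set.
  - by move=> u v; rewrite inE.
  - by rewrite nb0; split=> v; rewrite inE.
have [A [s [t [HA bA A0 apK]]]] := core_exists es hp n0 free D0 apD.
have [AD _ _ _ _] := HA.
have [d dP] : exists d : {K : {set V} | K \in comps e D A} -> rtd V,
    forall K, good_rtd e (val K) (d K) (3 * n).
  apply: (fin_all_exists (P := fun K l => good_rtd e (val K) l (3 * n))) => K.
  apply: IH; [|exact: apK (valP K)|exact: nb_posq es HA bA K].
  have KD := comps_sub (valP K).
  apply: leq_trans Dm; apply: proper_card; apply/properP; split.
    exact: subset_trans KD (subsetDl _ _).
  have [a aA] := set0Pn _ A0; exists a; first exact: (subsetP AD).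
  by apply/negP=> /(subsetP KD); rewrite inE aA.
by exists (glue s t d); apply: glue_good.
Qed.

Lemma tree_free_good_td (G : sgraph) par n : (forall j, 0 < j -> par j < j) -> 0 < n ->
  apex_tree_free (gadj G) par n -> has_good_td G (2 * (3 * n)) 3.
Proof.
move=> hp n0 free.
have nbT : nb (gadj G) setT = set0.
  by apply/setP=> u; rewrite [in RHS]inE; apply/negbTE/nbP; rewrite inE; case.
have apT : apexed (gadj G) setT.
  exists set0; split; first exact: connected0.
    by rewrite nbT.
  by rewrite -setI_eq0 set0I.
have [|d [rt bd_d _ ed [cov _ tops _ nar]]] := rtd_exists (@gsym G) hp n0 free apT.
  by rewrite nbT cards0.
apply: (has_good_td_rtd rt).
- by move=> x; have [] := bd_d x.
- by move=> u v uv; apply: ed; rewrite // inE in_setT.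
- by move=> v; split; [apply: cov | apply: tops | apply: nar].
Qed.

(** * The implications between the five conditions *)

Theorem theorem5 (C : sgraph -> Prop) (HC : minor_closed C) :
  [<-> exists H : sgraph, apex_forest H /\ ~ C H;
       bounded_local_pw C;
       linear_local_pw C;
       bounded_layered_pw C;
       exists w p : nat, forall G : sgraph, C G -> has_good_td G w p].
Proof.
have free : (exists H : sgraph, apex_forest H /\ ~ C H) ->
    exists par n, [/\ forall j, 0 < j -> par j < j, 0 < n &
      forall G, C G -> apex_tree_free (gadj G) par n].
  case=> H [/apex_forest_tree_free[par [n [hp n0 free]]] nCH].
  by exists par, n; split=> // G CG; apply: free => mHG; apply: nCH; apply: HC CG mHG.
have H14 : (exists H : sgraph, apex_forest H /\ ~ C H) -> bounded_layered_pw C.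
  move=> /free[par [n [hp n0 fr]]].
  by exists (3 * n) => G /fr; apply: layered_pw.
have H15 : (exists H : sgraph, apex_forest H /\ ~ C H) ->
    exists w p : nat, forall G : sgraph, C G -> has_good_td G w p.
  move=> /free[par [n [hp n0 fr]]].
  by exists (2 * (3 * n)), 3 => G /fr; apply: tree_free_good_td.
have H43 : bounded_layered_pw C -> linear_local_pw C.
  by case=> l Hl; exists (2 * l), l => G /Hl HG v r; apply: layered_local.
have H32 : linear_local_pw C -> bounded_local_pw C.
  by case=> a [b H]; exists (fun r => a * r + b).
have H21 : bounded_local_pw C -> exists H : sgraph, apex_forest H /\ ~ C H.
  case=> f Hf; exists (apex_tern (f 1).+1); split; first exact: apex_tern_forest.
  move=> /Hf/(_ None 1); rewrite (_ : ball _ 1 _ = setT); first exact: apex_tern_pathwidth.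
  apply/setP=> u; rewrite !inE; case: eqP => //= /eqP u0.
  by apply/existsP; exists None; rewrite inE eqxx; case: u u0.
have H51 : (exists w p : nat, forall G : sgraph, C G -> has_good_td G w p) ->
    exists H : sgraph, apex_forest H /\ ~ C H.
  case=> w [p Hwp]; exists (apex_tern (p.+1 * w.+1).+1); split; first exact: apex_tern_forest.
  move=> /Hwp/good_td_dominated/(_ (@apex_tern_dom _)).
  exact: apex_tern_pathwidth.
(* The implications from 1 to 4, 3, 2 and back, and from 1 to 5 and back, compose to the required
   cycle. *)
tfae; auto.
Qed.
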